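(* Let $A = (a_{ij})$ be an $m \times n$ matrix whose rows $A_i$ are independent isotropic random vectors in $\mathbb{R}^n$. Let $K$ be a number such that all entries satisfy $|a_{ij}| \le K$ almost surely. Then the normalized matrix $\bar{A} = \frac{1}{\sqrt{m}} A$ satisfies the following for $m \le n$, for every sparsity level $1 < k \le n$ and every number $\delta \in (0,1)$: $$\text{if } m \ge C\delta^{-2} k \log n\, \log^2(k)\, \log\big(\delta^{-2} k \log n\, \log^2 k\big), \quad \text{then } \mathbb{E}\,\delta_k(\bar{A}) \le \delta.$$ Here $C = C_K > 0$ may depend only on $K$.
   Context: For an $m\times n$ matrix $B$ and $k \ge 1$, the restricted isometry constant $\delta_k(B)$ is the smallest number $\delta_k \ge 0$ such that $$(1-\delta_k)\|x\|_2^2 \le \|Bx\|_2^2 \le (1+\delta_k)\|x\|_2^2$$ for all $x \in \mathbb{R}^n$ with $|\mathrm{supp}(x)| \le k$, where $\mathrm{supp}(x)$ is the set of indices of nonzero coordinates of $x$. A random vector $X$ in $\mathbb{R}^n$ is isotropic if $\mathbb{E}\, XX^T = I$, equivalently $\mathbb{E}\langle X,x\rangle^2 = \|x\|_2^2$ for all $x \in \mathbb{R}^n$ (no centering is assumed).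
   Formalization: Logarithms are taken to base 2: with natural logarithms the claim fails for k = n = 2, m = 1 and δ² > 2(ln 2)³, where the last logarithm is negative; for all other (k, n) the two versions agree up to the constant C. *)

(* Defs.v *)
From HB Require Import structures.
From mathcomp Require Import all_boot all_order all_algebra.
From mathcomp Require Import all_classical all_reals all_analysis.

Set Implicit Arguments.
Unset Strict Implicit.
Unset Printing Implicit Defensive.

Import Order.TTheory GRing.Theory Num.Theory.
Import numFieldNormedType.Exports.

Local Open Scope classical_set_scope.
Local Open Scope ring_scope.

(* The base 2 is significant only inside an iterated logarithm: a change of base
   multiplies log x by a constant, but it can change the sign of log (c * log x).
   Since log2 n >= 1 for n >= 2, expressions such as
   log2 (k * log2 n * log2 k ^+ 2) are positive for all k, n >= 2; with the
   natural logarithm this one is negative at k = n = 2. *)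
Definition log2 (R : realType) (x : R) : R := ln x / ln 2.

Definition norm2 (R : realType) (n : nat) (x : 'cV[R]_n) : R :=
  Num.sqrt (\sum_(j < n) x j ord0 ^+ 2).

Definition supp (R : realType) (n : nat) (x : 'cV[R]_n) : {set 'I_n} :=
  [set j | x j ord0 != 0]%SET.

Definition rip (R : realType) (m n k : nat) (B : 'M[R]_(m, n)) : set R :=
  [set delta | 0 <= delta /\
    forall x : 'cV[R]_n, (#|supp x| <= k)%N ->
      (1 - delta) * norm2 x ^+ 2 <= norm2 (B *m x) ^+ 2
        <= (1 + delta) * norm2 x ^+ 2].

(* The infimum is attained, see rip_constP. *)
Definition rip_const (R : realType) (m n k : nat) (B : 'M[R]_(m, n)) : R :=
  inf (rip k B).

Lemma norm2_sqr (R : realType) (n : nat) (x : 'cV[R]_n) :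
  norm2 x ^+ 2 = \sum_(j < n) x j ord0 ^+ 2.
Proof. by rewrite sqr_sqrtr// sumr_ge0// => j _; rewrite sqr_ge0. Qed.

Lemma ler_norm2_entry (R : realType) (n : nat) (x : 'cV[R]_n) (j : 'I_n) :
  `|x j ord0| <= norm2 x.
Proof.
rewrite -(@ler_pXn2r _ 2)// ?nnegrE ?sqrtr_ge0// norm2_sqr real_normK ?num_real//.
by rewrite (bigD1 j)//= lerDl sumr_ge0// => i _; rewrite sqr_ge0.
Qed.

Lemma rip_nonempty (R : realType) (m n k : nat) (B : 'M[R]_(m, n)) :
  rip k B !=set0.
Proof.
pose M := \sum_(i < m) (\sum_(j < n) `|B i j|) ^+ 2.
have M0 : 0 <= M by apply: sumr_ge0 => i _; rewrite sqr_ge0.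
exists (1 + M); split=> [|x _]; first by rewrite addr_ge0.
have leM : norm2 (B *m x) ^+ 2 <= M * norm2 x ^+ 2.
  rewrite norm2_sqr mulr_suml; apply: ler_sum => i _.
  rewrite -exprMn -(real_normK (num_real _)) lerXn2r ?nnegrE//.
    by rewrite mulr_ge0 ?sqrtr_ge0// sumr_ge0.
  rewrite mxE (le_trans (ler_norm_sum _ _ _))// mulr_suml.
  by apply: ler_sum => j _; rewrite normrM ler_wpM2l// ler_norm2_entry.
apply/andP; split.
  rewrite (@le_trans _ _ 0) ?sqr_ge0//.
  by rewrite opprD addNKr mulNr oppr_le0 mulr_ge0 ?sqr_ge0.
by rewrite (le_trans leM)// ler_wpM2r ?sqr_ge0// addrA lerDr addr_ge0.
Qed.

Lemma rip_constP (R : realType) (m n k : nat) (B : 'M[R]_(m, n)) :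
  rip k B (rip_const k B) /\
  forall delta, rip k B delta -> rip_const k B <= delta.
Proof.
have lb0 : lbound (rip k B) 0 by move=> d [].
have infS : has_inf (rip k B) by split; [exact: rip_nonempty|exists 0].
split; last by move=> d Sd; apply: ge_inf => //; exists 0.
split; first by apply: lb_le_inf => //; exact: rip_nonempty.
move=> x xk; set I := rip_const k B.
have key (e : R) : 0 < e ->
    (1 - I) * norm2 x ^+ 2 - e * norm2 x ^+ 2 <= norm2 (B *m x) ^+ 2
      <= (1 + I) * norm2 x ^+ 2 + e * norm2 x ^+ 2.
  move=> e0; have [d [_ /(_ _ xk)/andP[dl du]] dI] := inf_adherent e0 infS.
  rewrite -mulrBl -mulrDl; apply/andP; split.
    by apply: le_trans dl; rewrite ler_wpM2r ?sqr_ge0// -addrA -opprD lerD2l lerN2 ltW.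
  by apply: (le_trans du); rewrite ler_wpM2r ?sqr_ge0// -addrA lerD2l ltW.
have [x0|x0] := eqVneq (norm2 x ^+ 2) 0.
  by have := key 1 ltr01; rewrite x0 !mulr0 subr0 addr0.
have nx0 : 0 < norm2 x ^+ 2 by rewrite lt_neqAle eq_sym x0 sqr_ge0.
apply/andP; split; apply/ler_addgt0Pr => e e0.
  have /andP[+ _] := key _ (divr_gt0 e0 nx0).
  by rewrite divfK// lerBlDr.
by have /andP[_] := key _ (divr_gt0 e0 nx0); rewrite divfK.
Qed.

Definition mutually_independent (d d' : measure_display) (T : measurableType d)
    (T' : measurableType d') (R : realType) (P : probability T R)
    (I : finType) (X : I -> {RV P >-> T'}) : Prop :=
  forall (J : {set I}) (E : I -> set T'),
    (forall i, i \in J -> measurable (E i)) ->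
    P (\bigcap_(i in [set` J]) (X i @^-1` E i)) =
    (\prod_(i in J) P (X i @^-1` E i))%E.

(* The entrywise form of E[X X^T] = I. *)
Definition isotropic (d : measure_display) (T : measurableType d) (R : realType)
    (P : probability T R) (n : nat) (X : {RV P >-> n.-tuple R}) : Prop :=
  forall i j : 'I_n,
    ('E_P[fun w => (tnth (X w) i * tnth (X w) j)%R] = ((i == j)%:R)%:E)%E.

Arguments mutually_independent {d d' T T' R} P {I} X.
Arguments isotropic {d T R} P {n} X.

Definition random_mx (d : measure_display) (T : measurableType d) (R : realType)
    (P : probability T R) (m n : nat) (A : 'I_m -> {RV P >-> n.-tuple R})
    (w : T) : 'M[R]_(m, n) :=
  \matrix_(i, j) tnth (A i w) j.

(* Main.v *)
(* Chaining over a finite net, with empirical (Maurey) coverings. Up to a factor 2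
   the restricted isometry constant is the largest defect
   [| ||B x||^2 - ||x||^2 |] over a finite grid [X] of at most [n ^ (7 k)] sparse
   vectors of norm at most 1, so no infinite process occurs. Rounding the bounded
   entries of [A] to finitely many values turns the expectation into a finite sum
   with product weights, in which the deviation is symmetrized by Rademacher signs.
   For fixed rows [a_i], the process [sum_i e_i <a_i, x>^2] is controlled at scale
   [2^-j K sqrt k] of the seminorm [max_i |<a_i, x>|]: the grid lies in
   [sqrt k] times the l1-ball, so by Maurey's argument about [4^j log m] vertices of
   that ball approximate every grid point, and each of the [log2 k] scales
   contributes [K sqrt(k log m log n) R] with
   [R^2 = max_x sum_i <a_i, x>^2]. Below scale [K] the cardinality of [X] suffices.
   Since the mean of [R^2] is at most [m] times 2 plus the deviation itself, the
   resulting inequality is self-bounding. *)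
Require Import Defs.
From HB Require Import structures.
From mathcomp Require Import all_boot all_order all_algebra.
From mathcomp Require Import all_classical all_reals all_analysis.
From mathcomp Require Import measurable_realfun.
From mathcomp Require Import ring lra zify.
Set Implicit Arguments.
Unset Strict Implicit.
Unset Printing Implicit Defensive.
Import Order.TTheory GRing.Theory Num.Theory.
Import numFieldNormedType.Exports.
Import HBNNSimple.
Local Open Scope classical_set_scope.
Local Open Scope ring_scope.

Lemma expR_le_add_sqr (R : realType) (y : R) : expR y <= y + expR (2 * y ^+ 2).
Proof.
have [yh|yh] := leP y (1 / 2); last first.
  have : expR y <= expR (2 * y ^+ 2) by rewrite ler_expR; nra.
  by lra.
have e1 := expR_ge1Dx (- y); have e2 := expR_ge1Dx (2 * y ^+ 2).
have := expRxMexpNx_1 y; have := expR_gt0 y.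
move: (expR y) (expR (- y)) e1 => a b e1 a0 ab.
have : a * (1 - y) <= 1 by nra.
by nra.
Qed.

Definition rad_sum (R : realType) (m : nat) (e : {ffun 'I_m -> bool})
  (c : 'I_m -> R) : R := \sum_(i < m) (-1) ^+ e i * c i.

Definition rad_avg (R : realType) (m : nat) (F : {ffun 'I_m -> bool} -> R) : R :=
  (2 ^+ m)^-1 * \sum_e F e.

Lemma rad_avg_le (R : realType) (m : nat) (F G : {ffun 'I_m -> bool} -> R) :
  (forall e, F e <= G e) -> rad_avg F <= rad_avg G.
Proof.
move=> FG; rewrite ler_wpM2l ?invr_ge0 ?exprn_ge0//.
by apply: ler_sum => e _; exact: FG.
Qed.

Lemma rad_avgD (R : realType) (m : nat) (F G : {ffun 'I_m -> bool} -> R) :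
  rad_avg (fun e => F e + G e) = rad_avg F + rad_avg G.
Proof. by rewrite /rad_avg big_split mulrDr. Qed.

Lemma rad_avgZ (R : realType) (m : nat) (a : R) (F : {ffun 'I_m -> bool} -> R) :
  rad_avg (fun e => a * F e) = a * rad_avg F.
Proof. by rewrite /rad_avg -mulr_sumr mulrCA. Qed.

Lemma rad_avg_sum (R : realType) (m : nat) (I : Type) (r : seq I) (A : pred I)
    (F : I -> {ffun 'I_m -> bool} -> R) :
  rad_avg (fun e => \sum_(s <- r | A s) F s e) = \sum_(s <- r | A s) rad_avg (F s).
Proof. by rewrite /rad_avg exchange_big mulr_sumr. Qed.

Lemma rad_avg_cst (R : realType) (m : nat) (a : R) :
  rad_avg (fun _ : {ffun 'I_m -> bool} => a) = a.
Proof.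
rewrite /rad_avg sumr_const card_ffun card_bool card_ord -[a *+ _]mulr_natr natrX.
by rewrite mulrCA mulVf ?mulr1// expf_neq0.
Qed.

Lemma rad_sumN (R : realType) (m : nat) (e : {ffun 'I_m -> bool}) (c : 'I_m -> R) :
  rad_sum e (fun i => - c i) = - rad_sum e c.
Proof. by rewrite /rad_sum -sumrN; apply: eq_bigr => i _; rewrite mulrN. Qed.

Lemma rad_sumB (R : realType) (m : nat) (e : {ffun 'I_m -> bool}) (b c : 'I_m -> R) :
  rad_sum e (fun i => b i - c i) = rad_sum e b - rad_sum e c.
Proof. by rewrite /rad_sum -sumrB; apply: eq_bigr => i _; rewrite mulrBr. Qed.

Lemma rad_sumZ (R : realType) (m : nat) (e : {ffun 'I_m -> bool}) (a : R)
    (c : 'I_m -> R) :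
  rad_sum e (fun i => a * c i) = a * rad_sum e c.
Proof. by rewrite /rad_sum mulr_sumr; apply: eq_bigr => i _; rewrite mulrCA. Qed.

Lemma rad_mgf (R : realType) (m : nat) (c : 'I_m -> R) :
  rad_avg (fun e => expR (rad_sum e c)) <= expR (2 * \sum_(i < m) c i ^+ 2).
Proof.
rewrite /rad_avg ler_pdivrMl ?exprn_gt0//.
under eq_bigr do rewrite /rad_sum expR_sum.
rewrite -(bigA_distr_bigA (fun (i : 'I_m) (b : bool) => expR ((-1) ^+ b * c i))).
rewrite mulr_sumr expR_sum -[X in 2 ^+ X]card_ord -prodr_const -big_split.
apply: ler_prod => i _; rewrite big_bool/= expr0 mul1r expr1 mulN1r.
rewrite addr_ge0 ?expR_ge0//=.
have := expR_le_add_sqr (c i); have := expR_le_add_sqr (- c i).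
by rewrite sqrrN; lra.
Qed.

Lemma massart (R : realType) (m : nat) (I : finType) (A : {set I})
    (c : I -> 'I_m -> R) (s2 lam l : R) :
  A != finset.set0 -> 0 < lam ->
  (forall s, s \in A -> \sum_(i < m) c s i ^+ 2 <= s2) ->
  2 * #|A|%:R <= expR l ->
  rad_avg (fun e => \big[Num.max/0]_(s in A) `|rad_sum e (c s)|)
    <= (l + 2 * lam ^+ 2 * s2) / lam.
Proof.
move=> /set0Pn[s0 As0] lam0 cs lA; rewrite ler_pdivlMr// mulrC -rad_avgZ.
set l' := l + _.
pose V s e := expR (rad_sum e (fun i => lam * c s i)) +
              expR (rad_sum e (fun i => - (lam * c s i))).
pose U e := (l' - 1) + expR (- l') * \sum_(s in A) V s e.
have V0 s e : 0 <= V s e by rewrite addr_ge0 ?expR_ge0.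
have main e s : s \in A -> lam * `|rad_sum e (c s)| <= U e.
  move=> As; have := expR_ge1Dx (lam * `|rad_sum e (c s)| - l').
  have : expR (lam * `|rad_sum e (c s)| - l') <= expR (- l') * \sum_(s in A) V s e.
    rewrite addrC expRD ler_wpM2l ?expR_ge0// (bigD1 s)//=.
    rewrite (@le_trans _ _ (V s e)) ?lerDl ?sumr_ge0//.
    rewrite /V rad_sumN rad_sumZ; have [h|h] := lerP 0 (rad_sum e (c s)).
      by rewrite (ger0_norm h) lerDl expR_ge0.
    by rewrite (ltr0_norm h) mulrN lerDr expR_ge0.
  by rewrite /U; lra.
apply: (@le_trans _ _ (rad_avg U)).
  apply: rad_avg_le => e; rewrite -ler_pdivlMl//; apply: bigmax_le => [|s As].
    by rewrite mulr_ge0 ?invr_ge0 ?(ltW lam0)// (le_trans _ (main e s0 As0))// mulr_ge0// ltW.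
  by rewrite ler_pdivlMl// main.
rewrite rad_avgD rad_avg_cst rad_avgZ rad_avg_sum.
have : \sum_(s in A) rad_avg (V s) <= expR l'.
  rewrite (@le_trans _ _ (\sum_(s in A) 2 * expR (2 * lam ^+ 2 * s2)))//.
    apply: ler_sum => s As; rewrite rad_avgD.
    have e1 (u : R) (d : 'I_m -> R) : \sum_(i < m) d i ^+ 2 = lam ^+ 2 * u -> u <= s2 ->
        rad_avg (fun e => expR (rad_sum e d)) <= expR (2 * lam ^+ 2 * s2).
      move=> du us; apply: (le_trans (rad_mgf _)); rewrite ler_expR du -mulrA.
      by rewrite ler_wpM2l// ler_wpM2l// sqr_ge0.
    have h1 := e1 _ (fun i => lam * c s i) _ (cs s As).
    have h2 := e1 _ (fun i => - (lam * c s i)) _ (cs s As).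
    rewrite mulr2n mulrDl !mul1r lerD ?h1 ?h2// mulr_sumr; apply: eq_bigr => i _;
      by rewrite ?sqrrN exprMn.
  rewrite sumr_const -[_ *+ #|A|]mulr_natr mulrAC expRD ler_wpM2r ?expR_ge0//.
have := expRxMexpNx_1 l'; have := expR_gt0 (- l').
by move: (expR l') (expR (- l')) => a b; nra.
Qed.

Lemma exists_le_mean (R : realType) (I : finType) (w F : I -> R) (c : R) :
  (forall s, 0 <= w s) -> \sum_s w s = 1 -> \sum_s w s * F s <= c ->
  exists s, F s <= c.
Proof.
move=> w0 w1 wF; apply/not_existsP => cF.
have cF' s : c < F s by rewrite ltNge; apply/negP/cF.
have [s ws] : exists s, 0 < w s.
  apply/not_existsP => nw; suff : \sum_s w s <= 0 by rewrite w1 ler10.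
  by apply: sumr_le0 => s _; rewrite leNgt; apply/negP/nw.
have : \sum_s w s * c < \sum_s w s * F s.
  rewrite (bigD1 s)//= [X in _ < X](bigD1 s)//= ltr_leD ?ltr_pM2l//.
  by apply: ler_sum => s' _; rewrite ler_wpM2l// ltW.
by rewrite -mulr_suml w1 mul1r ltNge wF.
Qed.

Lemma centered_mgf (R : realType) (I : finType) (w Y : I -> R) (b : R) :
  (forall s, 0 <= w s) -> \sum_s w s = 1 -> \sum_s w s * Y s = 0 ->
  (forall s, `|Y s| <= b) ->
  \sum_s w s * expR (Y s) <= expR (2 * b ^+ 2).
Proof.
move=> w0 w1 wY Yb.
rewrite (@le_trans _ _ (\sum_s w s * (Y s + expR (2 * b ^+ 2))))//.
  apply: ler_sum => s _; rewrite ler_wpM2l// (le_trans (expR_le_add_sqr _))//.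
  rewrite lerD2l ler_expR ler_wpM2l// -[Y s ^+ 2]real_normK ?num_real//.
  by rewrite lerXn2r ?nnegrE// (le_trans _ (Yb s)).
by under eq_bigr do rewrite mulrDr; rewrite big_split/= wY add0r -mulr_suml w1 mul1r.
Qed.

Definition dot (R : realType) (n : nat) (u x : 'I_n -> R) : R := \sum_(j < n) u j * x j.

Lemma dotB (R : realType) (n : nat) (u x y : 'I_n -> R) :
  dot u (fun j => x j - y j) = dot u x - dot u y.
Proof. by rewrite /dot -sumrB; apply: eq_bigr => j _; rewrite mulrBr. Qed.

Lemma dot_l1 (R : realType) (n : nat) (u x : 'I_n -> R) (K : R) :
  (forall j, `|u j| <= K) -> `|dot u x| <= K * \sum_j `|x j|.
Proof.
move=> uK; rewrite (le_trans (ler_norm_sum _ _ _))// mulr_sumr.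
by apply: ler_sum => j _; rewrite normrM ler_wpM2r.
Qed.

(* [dot u] at the extreme points [0] and [+-b e_j] of the l1-ball of radius [b] *)
Definition vertex_dot (R : realType) (n : nat) (b : R) (u : 'I_n -> R)
    (s : option ('I_n * bool)) : R :=
  if s is Some (j, sg) then (-1) ^+ sg * b * u j else 0.

Definition vertex_weight (R : realType) (n : nat) (b : R) (x : 'I_n -> R)
    (s : option ('I_n * bool)) : R :=
  if s is Some (j, sg) then (if sg == (x j < 0) then `|x j| / b else 0)
  else 1 - (\sum_j `|x j|) / b.

Lemma vertex_weight_ge0 (R : realType) (n : nat) (b : R) (x : 'I_n -> R) s :
  0 < b -> \sum_j `|x j| <= b -> 0 <= vertex_weight b x s.
Proof.
move=> b0 xb; case: s => [[j sg]|]/=; last first.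
  by rewrite subr_ge0 ler_pdivrMr// mul1r.
by case: ifP => // _; rewrite divr_ge0// ltW.
Qed.

Lemma sum_option (R : realType) (I : finType) (F : option I -> R) :
  \sum_s F s = F None + \sum_i F (Some i).
Proof.
rewrite (bigD1 None)//=; congr (_ + _).
rewrite (reindex_omap Some id)/=; last by case.
by apply: eq_bigl => i; rewrite eqxx.
Qed.

Lemma vertex_sum (R : realType) (n : nat) (b : R) (x : 'I_n -> R)
    (F : option ('I_n * bool) -> R) :
  \sum_s vertex_weight b x s * F s =
  (1 - (\sum_j `|x j|) / b) * F None +
  \sum_j `|x j| / b * F (Some (j, x j < 0)).
Proof.
rewrite sum_option; congr (_ + _).
transitivity (\sum_j \sum_(sg : bool)
    vertex_weight b x (Some (j, sg)) * F (Some (j, sg))).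
  by rewrite pair_bigA; apply: eq_bigr => -[j sg].
apply: eq_bigr => j _; rewrite (bigD1 (x j < 0))//= eqxx big1 ?addr0// => sg.
by move/negPf => ->; rewrite mul0r.
Qed.

Lemma vertex_weight_sum (R : realType) (n : nat) (b : R) (x : 'I_n -> R) :
  \sum_s vertex_weight b x s = 1.
Proof.
under eq_bigr do rewrite -[vertex_weight _ _ _]mulr1.
rewrite vertex_sum mulr1; under [X in _ + X]eq_bigr do rewrite mulr1.
by rewrite -mulr_suml subrK.
Qed.

Lemma vertex_mean (R : realType) (n : nat) (b : R) (u x : 'I_n -> R) : 0 < b ->
  \sum_s vertex_weight b x s * vertex_dot b u s = dot u x.
Proof.
move=> b0; rewrite vertex_sum mulr0 add0r; apply: eq_bigr => j _ /=.
rewrite [in RHS](numEsign (x j)); field; exact: lt0r_neq0.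
Qed.

Lemma vertex_dot_le (R : realType) (n : nat) (b K : R) (u : 'I_n -> R) s :
  0 <= b -> 0 <= K -> (forall j, `|u j| <= K) -> `|vertex_dot b u s| <= K * b.
Proof.
move=> b0 K0 uK; case: s => [[j sg]|]/=; last by rewrite normr0 mulr_ge0.
by rewrite -mulrA normrMsign normrM (ger0_norm b0) mulrC ler_wpM2r.
Qed.

Definition cosh_sum (R : realType) (m : nat) (lam : R) (z : 'I_m -> R) : R :=
  \sum_(i < m) (expR (lam * z i) + expR (- (lam * z i))).

Lemma cosh_sum_step (R : realType) (m n : nat) (K b lam : R)
    (a : 'I_m -> 'I_n -> R) (x : 'I_n -> R) (z : 'I_m -> R) :
  0 < b -> 0 <= K -> 0 <= lam -> (forall i j, `|a i j| <= K) -> \sum_j `|x j| <= b ->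
  exists s, cosh_sum lam (fun i => z i + (vertex_dot b (a i) s - dot (a i) x))
    <= expR (8 * lam ^+ 2 * (K * b) ^+ 2) * cosh_sum lam z.
Proof.
move=> b0 K0 lam0 aK xb.
have w0 s := @vertex_weight_ge0 R n b x s b0 xb.
have w1 := vertex_weight_sum b x.
apply: (exists_le_mean w0 w1).
under eq_bigr do rewrite mulr_sumr.
rewrite exchange_big mulr_sumr; apply: ler_sum => i _ /=.
pose Y s := lam * (vertex_dot b (a i) s - dot (a i) x).
have Yb s : `|Y s| <= 2 * lam * (K * b).
  rewrite normrM (ger0_norm lam0) mulrAC [2 * _ * _]mulrC ler_wpM2l//.
  rewrite (le_trans (ler_normB _ _))// mulr_natl mulr2n lerD//.
    by rewrite vertex_dot_le// ltW.
  by rewrite (le_trans (dot_l1 _ (aK i)))// ler_wpM2l.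
have wY : \sum_s vertex_weight b x s * Y s = 0.
  under eq_bigr do rewrite /Y mulrBr mulrBr mulrCA mulrA.
  rewrite sumrB -mulr_suml w1 mul1r -[X in _ - X]mulr1.
  under eq_bigr do rewrite -mulrA.
  by rewrite -mulr_sumr vertex_mean// mulr1 subrr.
have e1 := centered_mgf w0 w1 wY Yb.
have wNY : \sum_s vertex_weight b x s * (- Y s) = 0.
  by under eq_bigr do rewrite mulrN; rewrite sumrN wY oppr0.
have e2 := centered_mgf w0 w1 wNY (fun s => eq_ind_r (fun t => t <= _) (Yb s) (normrN _)).
have -> : 8 * lam ^+ 2 * (K * b) ^+ 2 = 2 * (2 * lam * (K * b)) ^+ 2 by ring.
rewrite mulrDr [X in _ <= X + _]mulrC [X in _ <= _ + X]mulrC.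
have -> : \sum_s vertex_weight b x s *
    (expR (lam * (z i + (vertex_dot b (a i) s - dot (a i) x))) +
     expR (- (lam * (z i + (vertex_dot b (a i) s - dot (a i) x))))) =
  expR (lam * z i) * (\sum_s vertex_weight b x s * expR (Y s)) +
  expR (- (lam * z i)) * (\sum_s vertex_weight b x s * expR (- Y s)).
  rewrite !mulr_sumr -big_split/=; apply: eq_bigr => s _.
  by rewrite (mulrDr lam) -/(Y s) opprD !expRD; ring.
by rewrite lerD// ler_wpM2l// expR_ge0.
Qed.

Lemma maurey (R : realType) (m n : nat) (K b lam L : R)
    (a : 'I_m -> 'I_n -> R) (x : 'I_n -> R) (q : nat) :
  0 < b -> 0 <= K -> 0 <= lam -> (forall i j, `|a i j| <= K) -> \sum_j `|x j| <= b ->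
  2 * m%:R <= expR L ->
  exists t : q.-tuple (option ('I_n * bool)), forall i,
    lam * `|\sum_(s <- t) vertex_dot b (a i) s - q%:R * dot (a i) x|
      <= L + 8 * q%:R * lam ^+ 2 * (K * b) ^+ 2.
Proof.
move=> b0 K0 lam0 aK xb mL.
pose z (t : seq (option ('I_n * bool))) i :=
  \sum_(s <- t) vertex_dot b (a i) s - (size t)%:R * dot (a i) x.
have [t tz] : exists t : q.-tuple (option ('I_n * bool)),
    cosh_sum lam (z t) <= expR (8 * lam ^+ 2 * (K * b) ^+ 2) ^+ q * (2 * m%:R).
  elim: q => [|q [t tz]].
    exists [tuple]; rewrite expr0 mul1r /cosh_sum.
    under eq_bigr do rewrite /z big_nil mul0r subr0 mulr0 oppr0 expR0.
    by rewrite sumr_const card_ord -[X in X <= _]mulr_natr.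
  have [s sz] := cosh_sum_step (z t) b0 K0 lam0 aK xb.
  exists [tuple of s :: t]; rewrite exprS -mulrA.
  apply: le_trans (ler_wpM2l (expR_ge0 _) tz); apply: le_trans sz.
  rewrite le_eqVlt; apply/orP; left; apply/eqP; apply: eq_bigr => i _.
  have -> // : z [tuple of s :: t] i = z t i + (vertex_dot b (a i) s - dot (a i) x).
  by rewrite /z/= big_cons -[(size t).+1%:R]natr1; ring.
exists t => i; rewrite -ler_expR.
have e1 : expR (lam * `|z t i|) <= cosh_sum lam (z t).
  rewrite /cosh_sum (bigD1 i)//= -[X in X <= _]addr0 lerD//; last first.
    by apply: sumr_ge0 => j _; rewrite addr_ge0 ?expR_ge0.
  have [h|h] := lerP 0 (z t i); first by rewrite (ger0_norm h) lerDl expR_ge0.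
  by rewrite (ltr0_norm h) mulrN lerDr expR_ge0.
rewrite -[X in _ - X%:R * _](size_tuple t) (le_trans e1)// (le_trans tz)// addrC expRD.
rewrite -expRM_natl; set u := _ * expR L.
by rewrite (le_trans (ler_wpM2l (expR_ge0 _) mL))// /u !mulrA [8 * _]mulrC.
Qed.

Lemma maurey_net (R : realType) (m n : nat) (K b : R) (X : finType)
    (a : 'I_m -> 'I_n -> R) (pt : X -> 'I_n -> R) (j Q : nat) :
  0 < b -> 0 < K -> (forall i j, `|a i j| <= K) -> (forall x, \sum_j `|pt x j| <= b) ->
  2 * m%:R <= expR (Q%:R : R) -> (0 < Q)%N ->
  exists p : X -> X, (#|p @: [set: X]%SET| <= (2 * n).+1 ^ (4 ^ j * Q))%N /\
    forall x i, `|dot (a i) (pt x) - dot (a i) (pt (p x))| <= 18 * (K * b) / 2 ^+ j.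
Proof.
move=> b0 K0 aK xb mQ Q0; set q := (4 ^ j * Q)%N.
have B0 : 0 < K * b by rewrite mulr_gt0.
pose lam := (2 ^+ j * (K * b))^-1.
have lam0 : 0 < lam by rewrite invr_gt0 mulr_gt0// exprn_gt0.
have [code codeP] := choice (fun x => maurey q b0 (ltW K0) (ltW lam0) aK (xb x) mQ).
have [x0 _|X0] := pickP (fun _ : X => true); last first.
  exists id; split; last by move=> x; have := X0 x.
  rewrite (_ : _ @: _ = finset.set0) ?cards0//.
  by apply/setP => x; have := X0 x.
pose g s := odflt x0 [pick y | code y == s].
exists (g \o code); split.
  rewrite imset_comp (leq_trans (leq_imset_card _ _))//.
  rewrite (leq_trans (max_card _))// card_tuple card_option card_prod card_ord card_bool.
  by rewrite mulnC.
move=> x i.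
have cg : code (g (code x)) = code x.
  by rewrite /g; case: pickP => [y /eqP//|/(_ x)]; rewrite eqxx.
have h1 := codeP x i; have h2 := codeP (g (code x)) i.
rewrite cg in h2; move: h1 h2.
set U := \sum_(s <- _) _; set d1 := dot _ _; set d2 := dot _ _ => h1 h2.
have qE : q%:R = (2 ^+ j) ^+ 2 * Q%:R :> R.
  rewrite natrM; congr (_ * _); rewrite -exprM mulnC exprM -natrX natrX.
  by congr (_ ^+ _); rewrite -natrX.
have Q0' : 0 < Q%:R :> R by rewrite ltr0n.
have j0 : 0 < 2 ^+ j :> R by rewrite exprn_gt0.
rewrite qE in h1 h2; rewrite ler_pdivlMr//.
have lE : 8 * ((2 ^+ j) ^+ 2 * Q%:R) * lam ^+ 2 * (K * b) ^+ 2 = 8 * Q%:R.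
  by rewrite /lam; field; rewrite !lt0r_neq0.
rewrite lE in h1 h2.
have h3 : lam * `|2 ^+ j ^+ 2 * Q%:R * (d1 - d2)| <= 18 * Q%:R.
  have -> : 2 ^+ j ^+ 2 * Q%:R * (d1 - d2) =
    (U - 2 ^+ j ^+ 2 * Q%:R * d2) - (U - 2 ^+ j ^+ 2 * Q%:R * d1) by ring.
  have := ler_normB (U - 2 ^+ j ^+ 2 * Q%:R * d2) (U - 2 ^+ j ^+ 2 * Q%:R * d1).
  by nra.
move: h3; rewrite normrM ger0_norm ?mulr_ge0 ?exprn_ge0//.
have -> : lam * (2 ^+ j ^+ 2 * Q%:R * `|d1 - d2|) = `|d1 - d2| * 2 ^+ j / (K * b) * Q%:R.
  by rewrite /lam; field; rewrite !lt0r_neq0.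
by rewrite ler_pM2r// ler_pdivrMr.
Qed.

Lemma chain_link (R : realType) (m n : nat) (X : finType) (x0 : X)
    (a : 'I_m -> 'I_n -> R) (pt : X -> 'I_n -> R) (p p' : X -> X) (d r lam l : R) :
  0 < lam -> (forall x, \sum_i dot (a i) (pt x) ^+ 2 <= r ^+ 2) ->
  (forall x i, `|dot (a i) (pt (p x)) - dot (a i) (pt (p' x))| <= d) ->
  2 * (#|p @: [set: X]%SET| * #|p' @: [set: X]%SET|)%:R <= expR l ->
  rad_avg (fun e => \big[Num.max/0]_x
      `|rad_sum e (fun i => dot (a i) (pt (p x)) ^+ 2 - dot (a i) (pt (p' x)) ^+ 2)|)
    <= (l + 8 * (lam * d * r) ^+ 2) / lam.
Proof.
move=> lam0 ar pd lN.
pose A := [set (p x, p' x) | x in [set: X]%SET]%SET.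
pose c (s : X * X) i := dot (a i) (pt s.1) ^+ 2 - dot (a i) (pt s.2) ^+ 2.
have inA x : (p x, p' x) \in A by apply/imsetP; exists x.
have A0 : A != finset.set0 by apply/set0Pn; exists (p x0, p' x0).
have cs s : s \in A -> \sum_(i < m) c s i ^+ 2 <= 4 * d ^+ 2 * r ^+ 2.
  move=> /imsetP[x _ ->]; rewrite /c/=.
  rewrite (@le_trans _ _ (\sum_i d ^+ 2 *
      (2 * dot (a i) (pt (p x)) ^+ 2 + 2 * dot (a i) (pt (p' x)) ^+ 2)))//.
    apply: ler_sum => i _; rewrite subr_sqr exprMn ler_pM ?sqr_ge0//.
      rewrite -[X in X <= _]real_normK ?num_real// lerXn2r ?nnegrE//.
      exact: le_trans (pd x i).
    rewrite -subr_ge0; set u := dot _ _; set v := dot _ _.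
    rewrite (_ : _ - _ = (u - v) ^+ 2) ?sqr_ge0//; ring.
  have -> : 4 * d ^+ 2 * r ^+ 2 = d ^+ 2 * (4 * r ^+ 2) by ring.
  rewrite -mulr_sumr big_split/= -!mulr_sumr ler_wpM2l ?sqr_ge0//.
  by have := ar (p x); have := ar (p' x); lra.
have lA : 2 * #|A|%:R <= expR l.
  rewrite (le_trans _ lN)// ler_wpM2l// ler_nat -cardsX subset_leq_card//.
  by apply/fintype.subsetP => s /imsetP[x _ ->]; rewrite finset.in_setX !imset_f ?inE.
have -> : 8 * (lam * d * r) ^+ 2 = 2 * lam ^+ 2 * (4 * d ^+ 2 * r ^+ 2) by ring.
apply: le_trans (massart A0 lam0 cs lA).
apply: rad_avg_le => e; apply: bigmax_le => [|x _].
  exact: bigmax_ge_id.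
by apply: (bigmax_sup (p x, p' x)).
Qed.

Lemma uniform_rudelson (R : realType) (m n Q J N : nat) (K b r S : R) (X : finType)
    (x0 : X) (a : 'I_m -> 'I_n -> R) (pt : X -> 'I_n -> R) :
  0 < b -> 0 < K -> 0 < r -> 0 < S -> (1 < n)%N -> (0 < Q)%N ->
  (forall i j, `|a i j| <= K) -> (forall x, \sum_j `|pt x j| <= b) ->
  (forall j, pt x0 j = 0) ->
  (forall x, \sum_i dot (a i) (pt x) ^+ 2 <= r ^+ 2) ->
  2 * m%:R <= expR (Q%:R : R) -> b <= 2 ^+ J -> Q%:R * ln n%:R <= S ^+ 2 ->
  (#|X| <= n ^ N)%N -> N%:R <= 7 * b ^+ 2 -> 1 <= b ->
  rad_avg (fun e => \big[Num.max/0]_x `|rad_sum e (fun i => dot (a i) (pt x) ^+ 2)|)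
    <= 2 ^+ 14 * (K * b) * S * r * J.+1%:R.
Proof.
move=> b0 K0 r0 S0 n1 Q0 aK xb pt0 ar mQ bJ QS XN Nb b1.
have B0 : 0 < K * b by rewrite mulr_gt0.
have nR : 0 < n%:R :> R by rewrite ltr0n (ltn_trans _ n1).
have ln2n : ln 2 <= ln n%:R :> R by rewrite ler_ln ?posrE// ler_nat.
have ln20 : 0 < ln 2 :> R by rewrite ln_gt0// ltr1n.
have L0 : 0 < ln n%:R :> R by exact: lt_le_trans ln2n.
have LS : ln n%:R <= S ^+ 2.
  by apply: le_trans QS; rewrite ler_peMl ?(ltW L0)// ler1n.
have expn t u : (u%:R <= t) -> (n ^ u)%:R <= expR (t * ln n%:R) :> R.
  move=> ut; rewrite natrX -[n%:R ^+ u]lnK ?posrE ?exprn_gt0// ler_expR lnXn//.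
  by rewrite -[_ *+ u]mulr_natl ler_wpM2r// ltW.
have exp2 u (k : nat) t : (k <= n ^ u)%N -> (u%:R + 1) * ln n%:R <= t ->
    2 * k%:R <= expR t :> R.
  move=> ku ut; rewrite (@le_trans _ _ (expR ((u%:R + 1) * ln n%:R)))// ?ler_expR//.
  apply: le_trans (expn _ u.+1 _); last by rewrite natr1.
  by rewrite expnS natrM ler_pM// ler_nat.
pose net j (p : X -> X) := (#|p @: [set: X]%SET| <= (2 * n).+1 ^ (4 ^ j * Q))%N /\
    (forall x i, `|dot (a i) (pt x) - dot (a i) (pt (p x))| <= 18 * (K * b) / 2 ^+ j).
have nets j : exists p, net j p /\ (j = 0%N -> p = fun=> x0).
  case: j => [|j]; last by have [p pP] := maurey_net j.+1 b0 K0 aK xb mQ Q0; exists p.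
  exists (fun=> x0); split=> //; split=> [|x i].
    rewrite (@leq_trans #|[set x0]%SET|)//; last by rewrite cards1 expn_gt0.
    by rewrite subset_leq_card//; apply/fintype.subsetP => y /imsetP[? _ ->]; rewrite inE.
  rewrite expr0 divr1 -dotB.
  have -> : (fun j => pt x j - pt x0 j) = pt x by apply/funext => j; rewrite pt0 subr0.
  rewrite (le_trans (dot_l1 _ (aK i)))// (@le_trans _ _ (K * b))//.
    by rewrite ler_wpM2l// ltW.
  by rewrite ler_peMl ?(ltW B0)// ler1n.
have [p pP] := choice nets.
have x_net j x i : `|dot (a i) (pt x) - dot (a i) (pt (p j x))| <= 18 * (K * b) / 2 ^+ j.
  exact: (pP j).1.2.
pose sq x i := dot (a i) (pt x) ^+ 2.
pose M j e := \big[Num.max/0]_x `|rad_sum e (fun i => sq (p j x) i - sq (p j.+1 x) i)|.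
pose M' e := \big[Num.max/0]_x `|rad_sum e (fun i => sq x i - sq (p J x) i)|.
have Mj j : rad_avg (M j) <= 2 ^+ 14 * (K * b) * S * r.
  pose lam := 4 ^+ j * S / ((K * b) * r).
  have lam0 : 0 < lam by rewrite divr_gt0 ?mulr_gt0 ?exprn_gt0.
  pose l : R := 16 * 4 ^+ j * S ^+ 2.
  have j0 : 0 < 2 ^+ j :> R by rewrite exprn_gt0.
  have j4 : 4 ^+ j = (2 ^+ j) ^+ 2 :> R by rewrite -exprM mulnC exprM expr2 -natrM.
  have := @chain_link R m n X x0 a pt (p j) (p j.+1) (36 * (K * b) / 2 ^+ j) r lam l lam0 ar.
  have -> : (l + 8 * (lam * (36 * (K * b) / 2 ^+ j) * r) ^+ 2) / lam =
      10384 * (K * b) * S * r.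
    by rewrite /l /lam j4; field; rewrite !lt0r_neq0.
  move=> hh; apply: (@le_trans _ _ (10384 * (K * b) * S * r)); last first.
    by rewrite !ler_pM2r// -natrX ler_nat.
  move: hh; apply.
    move=> x i; have h1 := x_net j x i; have h2 := x_net j.+1 x i.
    have e2 : 18 * (K * b) / 2 ^+ j.+1 = 18 * (K * b) / 2 ^+ j / 2.
      by rewrite exprS; field; rewrite lt0r_neq0.
    have e1 : 36 * (K * b) / 2 ^+ j = 18 * (K * b) / 2 ^+ j * 2.
      by field; rewrite lt0r_neq0.
    rewrite e2 in h2; rewrite e1 distrC in h1 *.
    have := le_trans (ler_distD (dot (a i) (pt x)) _ _) (lerD h1 h2).
    have : 0 < 18 * (K * b) / 2 ^+ j by rewrite divr_gt0// mulr_gt0.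
    by lra.
  have [[c1 _] _] := pP j; have [[c2 _] _] := pP j.+1.
  apply: (exp2 (3 * (4 ^ j * Q + 4 ^ j.+1 * Q))%N).
    apply: leq_trans (leq_mul c1 c2) _; rewrite -expnD expnM leq_exp2r.
      apply: (@leq_trans (2 ^ 2 * n)); first by clear -n1; lia.
      by rewrite (expnSr n 2) leq_mul2r leq_exp2r// n1 orbT.
    by rewrite addn_gt0 muln_gt0 expn_gt0 Q0.
  rewrite /l; have q1 : 1 <= 4 ^+ j * Q%:R :> R.
    by rewrite -natrX -natrM ler1n muln_gt0 expn_gt0 Q0.
  have -> : (3 * (4 ^ j * Q + 4 ^ j.+1 * Q))%:R = 15 * (4 ^+ j * Q%:R) :> R.
    by rewrite expnS !natrM natrD !natrM natrX; ring.
  rewrite (@le_trans _ _ (16 * (4 ^+ j * Q%:R) * ln n%:R))//.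
    by rewrite ler_pM2r//; lra.
  by rewrite -!mulrA ler_pM2l// ler_wpM2l// ltW// j4 exprn_gt0.
have M'J : rad_avg M' <= 2 ^+ 14 * (K * b) * S * r.
  pose lam := b * S / (K * r).
  have lam0 : 0 < lam by rewrite divr_gt0 ?mulr_gt0 ?exprn_gt0.
  pose l : R := 15 * b ^+ 2 * S ^+ 2.
  have := @chain_link R m n X x0 a pt id (p J) (18 * K) r lam l lam0 ar.
  have /[swap]/[apply] : forall x i, `|dot (a i) (pt x) - dot (a i) (pt (p J x))| <= 18 * K.
    move=> x i; apply: le_trans (x_net J x i) _.
    rewrite ler_pdivrMr ?exprn_gt0//; nra.
  move=> h; apply: le_trans (h _) _; last first.
    have -> : (l + 8 * (lam * (18 * K) * r) ^+ 2) / lam = 2607 * (K * b) * S * r.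
      rewrite /l /lam; field; rewrite !lt0r_neq0//.
    by rewrite !ler_pM2r//; lra.
  apply: (exp2 (N + N)%N).
    by rewrite expnD leq_mul// (leq_trans _ XN)// max_card.
  rewrite natrD /l ler_pM//; last by nra.
  exact: ltW.
have sumJ e x : `|rad_sum e (sq x)| <= M' e + \sum_(j < J) M j e.
  have -> : rad_sum e (sq x) = rad_sum e (fun i => sq x i - sq (p J x) i) -
      \sum_(j < J) rad_sum e (fun i => sq (p j x) i - sq (p j.+1 x) i).
    under eq_bigr do rewrite rad_sumB.
    rewrite -(big_mkord predT (fun j => rad_sum e (sq (p j x)) - rad_sum e (sq (p j.+1 x)))).
    have p0 i : sq (p 0%N x) i = 0.
      rewrite (pP 0%N).2// /sq /dot big1 ?expr0n// => j _.
      by rewrite pt0 mulr0.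
    have s0 : rad_sum e (sq (p 0%N x)) = 0.
      by rewrite /rad_sum big1// => i _; rewrite p0 mulr0.
    under eq_bigr do rewrite -opprB.
    by rewrite sumrN telescope_sumr// s0 rad_sumB; ring.
  rewrite (le_trans (ler_normB _ _))// lerD//; first exact: (bigmax_sup x).
  rewrite (le_trans (ler_norm_sum _ _ _))//; apply: ler_sum => j _.
  exact: (bigmax_sup x).
apply: (@le_trans _ _ (rad_avg (fun e => M' e + \sum_(j < J) M j e))).
  apply: rad_avg_le => e; apply: bigmax_le => [|x _]; last exact: sumJ.
  exact: le_trans (normr_ge0 _) (sumJ e x0).
rewrite rad_avgD rad_avg_sum -[J.+1%:R]natr1 mulrDr addrC mulr1 lerD// mulr_natr.
by rewrite -[J in X in _ <= X]card_ord -sumr_const ler_sum.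
Qed.

Definition prod_weight (R : realType) (m : nat) (V : finType) (p : 'I_m -> V -> R)
    (v : {ffun 'I_m -> V}) : R := \prod_i p i (v i).

Definition sup_norm (R : realType) (X : finType) (F : X -> R) : R :=
  \big[Num.max/0]_x `|F x|.

Lemma sup_norm_ge (R : realType) (X : finType) (F : X -> R) (x : X) :
  `|F x| <= sup_norm F.
Proof. exact: (bigmax_sup x). Qed.

Lemma sup_norm_ge0 (R : realType) (X : finType) (F : X -> R) : 0 <= sup_norm F.
Proof. exact: bigmax_ge_id. Qed.

Lemma sup_norm_le (R : realType) (X : finType) (F : X -> R) (c : R) :
  0 <= c -> (forall x, `|F x| <= c) -> sup_norm F <= c.
Proof. by move=> c0 Fc; exact: bigmax_le. Qed.

Lemma prod_weight_ge0 (R : realType) (m : nat) (V : finType) (p : 'I_m -> V -> R) v :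
  (forall i u, 0 <= p i u) -> 0 <= prod_weight p v.
Proof. by move=> p0; apply: prodr_ge0. Qed.

Lemma prod_weight_sum (R : realType) (m : nat) (V : finType) (p : 'I_m -> V -> R) :
  (forall i, \sum_u p i u = 1) -> \sum_v prod_weight p v = 1.
Proof.
by move=> p1; rewrite -(bigA_distr_bigA (fun i u => p i u)) big1.
Qed.

Lemma prod_weight_marginal (R : realType) (m : nat) (V : finType)
    (p : 'I_m -> V -> R) (i0 : 'I_m) (h : V -> R) :
  (forall i, \sum_u p i u = 1) ->
  \sum_v prod_weight p v * h (v i0) = \sum_u p i0 u * h u.
Proof.
move=> p1.
pose q i u := if i == i0 then p i u * h u else p i u.
transitivity (\sum_(v : {ffun 'I_m -> V}) \prod_i q i (v i)).
  apply: eq_bigr => v _; rewrite /prod_weight (bigD1 i0)//= [RHS](bigD1 i0)//=.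
  rewrite {1}/q eqxx mulrAC; congr (_ * _).
  by apply: eq_bigr => i /negPf ii0; rewrite /q ii0.
rewrite -bigA_distr_bigA (bigD1 i0)//= [X in _ * X]big1 ?mulr1.
  by apply: eq_bigr => u _; rewrite /q eqxx.
by move=> i /negPf ii0; rewrite -[RHS](p1 i); apply: eq_bigr => u _; rewrite /q ii0.
Qed.

Definition swap_pair (m : nat) (V : finType) (e : {ffun 'I_m -> bool})
    (s : {ffun 'I_m -> V} * {ffun 'I_m -> V}) : {ffun 'I_m -> V} * {ffun 'I_m -> V} :=
  ([ffun i => if e i then s.2 i else s.1 i], [ffun i => if e i then s.1 i else s.2 i]).

Lemma swap_pairK (m : nat) (V : finType) (e : {ffun 'I_m -> bool}) :
  involutive (@swap_pair m V e).
Proof.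
by case=> v v'; congr (_, _); apply/ffunP => i; rewrite !ffunE/=; case: (e i).
Qed.

Lemma swap_pair_weight (R : realType) (m : nat) (V : finType) (p : 'I_m -> V -> R)
    (e : {ffun 'I_m -> bool}) s :
  prod_weight p (swap_pair e s).1 * prod_weight p (swap_pair e s).2 =
  prod_weight p s.1 * prod_weight p s.2.
Proof.
rewrite /prod_weight -!big_split/=; apply: eq_bigr => i _.
by rewrite !ffunE; case: (e i); rewrite // mulrC.
Qed.

Lemma symmetrization (R : realType) (m : nat) (V X : finType) (p : 'I_m -> V -> R)
    (f : V -> X -> R) :
  (forall i u, 0 <= p i u) -> (forall i, \sum_u p i u = 1) ->
  \sum_v prod_weight p v *
      sup_norm (fun x => \sum_i (f (v i) x - \sum_u p i u * f u x))
  <= 2 * \sum_v prod_weight p v *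
      rad_avg (fun e => sup_norm (fun x => rad_sum e (fun i => f (v i) x))).
Proof.
move=> p0 p1.
set w := prod_weight p.
have w0 v : 0 <= w v by exact: prod_weight_ge0.
have w1 : \sum_v w v = 1 by exact: prod_weight_sum.
pose D (s : {ffun 'I_m -> V} * {ffun 'I_m -> V}) x i := f (s.1 i) x - f (s.2 i) x.
pose Phi s := sup_norm (fun x => \sum_i D s x i).
pose rhs (v : {ffun 'I_m -> V}) e := sup_norm (fun x => rad_sum e (fun i => f (v i) x)).
apply: (@le_trans _ _ (\sum_s w s.1 * w s.2 * Phi s)).
  rewrite -(pair_bigA _ (fun v v' => w v * w v' * Phi (v, v')))/=.
  apply: ler_sum => v _; under [X in _ <= X]eq_bigr do rewrite -mulrA.
  rewrite -mulr_sumr ler_wpM2l//.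
  apply: sup_norm_le => [|x].
    by apply: sumr_ge0 => v' _; rewrite mulr_ge0// sup_norm_ge0.
  have -> : \sum_i (f (v i) x - \sum_u p i u * f u x) = \sum_v' w v' * \sum_i D (v, v') x i.
    under [RHS]eq_bigr do rewrite mulr_sumr.
    rewrite exchange_big; apply: eq_bigr => i _ /=.
    under [RHS]eq_bigr do rewrite /D mulrBr /=.
    rewrite sumrB; congr (_ - _); first by rewrite -mulr_suml w1 mul1r.
    by rewrite (prod_weight_marginal i (fun u => f u x) p1).
  rewrite (le_trans (ler_norm_sum _ _ _))//; apply: ler_sum => v' _.
  rewrite normrM (ger0_norm (w0 v')) ler_wpM2l//.
  exact: (sup_norm_ge (fun x => \sum_i D (v, v') x i)).
have swapE e : \sum_s w s.1 * w s.2 * Phi s =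
    \sum_s w s.1 * w s.2 * sup_norm (fun x => rad_sum e (D s x)).
  rewrite (reindex_inj (inv_inj (swap_pairK e)))/=; apply: eq_bigr => s _.
  rewrite swap_pair_weight; congr (_ * _); apply: eq_bigr => x _; congr `|_|.
  apply: eq_bigr => i _; rewrite /D !ffunE.
  by case: (e i); rewrite ?expr0 ?mul1r// expr1 mulN1r opprB.
rewrite -(rad_avg_cst m (\sum_s _)).
under [X in _ <= _ * X]eq_bigr do rewrite -rad_avgZ.
rewrite -rad_avg_sum -rad_avgZ; apply: rad_avg_le => e.
rewrite /= (swapE e) (@le_trans _ _ (\sum_s w s.1 * w s.2 * (rhs s.1 e + rhs s.2 e)))//.
  apply: ler_sum => s _; rewrite ler_wpM2l ?mulr_ge0//.
  apply: sup_norm_le => [|x]; first by rewrite addr_ge0 ?sup_norm_ge0.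
  rewrite /D rad_sumB (le_trans (ler_normB _ _))// lerD//.
    exact: (sup_norm_ge (fun x => rad_sum e (fun i => f (s.1 i) x))).
  exact: (sup_norm_ge (fun x => rad_sum e (fun i => f (s.2 i) x))).
rewrite -(pair_bigA _ (fun v v' => w v * w v' * (rhs v e + rhs v' e)))/=.
rewrite le_eqVlt; apply/orP; left; apply/eqP.
transitivity (\sum_v (w v * rhs v e + w v * \sum_v' w v' * rhs v' e)).
  apply: eq_bigr => v _; under eq_bigr do rewrite mulrDr -mulrA -[X in _ + X]mulrA.
  rewrite big_split/= -!mulr_sumr -mulr_suml w1 mul1r.
  by congr (_ + _).
by rewrite big_split/= -mulr_suml w1 mul1r mulr2n mulrDl !mul1r.
Qed.

Lemma finite_deviation (R : realType) (m n Q J N : nat) (K b S : R) (V X : finType)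
    (x0 : X) (p : 'I_m -> V -> R) (val : V -> 'I_n -> R) (pt : X -> 'I_n -> R) :
  (forall i u, 0 <= p i u) -> (forall i, \sum_u p i u = 1) ->
  (forall u j, `|val u j| <= K) ->
  (forall x, \sum_i \sum_u p i u * dot (val u) (pt x) ^+ 2 <= 2 * m%:R) ->
  0 < K -> 0 < S -> (1 < n)%N -> (0 < m)%N -> (0 < Q)%N ->
  (forall x, \sum_j `|pt x j| <= b) -> (forall j, pt x0 j = 0) ->
  2 * m%:R <= expR (Q%:R : R) -> b <= 2 ^+ J -> Q%:R * ln n%:R <= S ^+ 2 ->
  (#|X| <= n ^ N)%N -> N%:R <= 7 * b ^+ 2 -> 1 <= b ->
  2 ^+ 14 * (K * b) * S * J.+1%:R <= Num.sqrt m%:R / 2 ->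
  \sum_v prod_weight p v *
      sup_norm (fun x => \sum_i (dot (val (v i)) (pt x) ^+ 2
                                - \sum_u p i u * dot (val u) (pt x) ^+ 2))
    <= 6 * (2 ^+ 14 * (K * b) * S * J.+1%:R) * Num.sqrt m%:R.
Proof.
move=> p0 p1 vK g2 K0 S0 n1 m0 Q0 xb pt0 mQ bJ QS XN Nb b1.
set c := 2 ^+ 14 * _ * _ * _; set tau := Num.sqrt m%:R => ct.
have b0 : 0 < b by exact: lt_le_trans b1.
have c0 : 0 <= c by rewrite !mulr_ge0 ?exprn_ge0// ltW.
have tau0 : 0 < tau by rewrite sqrtr_gt0 ltr0n.
have tau2 : tau ^+ 2 = m%:R by rewrite sqr_sqrtr.
pose f u x := dot (val u) (pt x) ^+ 2.
pose dev (v : {ffun 'I_m -> V}) :=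
  sup_norm (fun x => \sum_i (f (v i) x - \sum_u p i u * f u x)).
set D := \sum_v _.
set w := prod_weight p.
have w0 v : 0 <= w v by exact: prod_weight_ge0.
have w1 : \sum_v w v = 1 by exact: prod_weight_sum.
(* By AM-GM, [r v] bounds the square root of [sup_x \sum_i f (v i) x]. *)
pose r (v : {ffun 'I_m -> V}) : R := (tau + (dev v + 2 * m%:R) / tau) / 2.
have dev0 v : 0 <= dev v by exact: sup_norm_ge0.
have r0 v : 0 < r v.
  by rewrite divr_gt0// ltr_wpDr// divr_ge0 ?(ltW tau0)// addr_ge0// mulr_ge0.
have fr (v : {ffun 'I_m -> V}) x : \sum_i f (v i) x <= r v ^+ 2.
  have h1 : \sum_i f (v i) x <= dev v + 2 * m%:R.
    have := le_trans (ler_norm _)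
      (sup_norm_ge (fun x => \sum_i (f (v i) x - \sum_u p i u * f u x)) x).
    by have := g2 x; rewrite sumrB -/(dev v); lra.
  apply: (le_trans h1); set t := dev v + _.
  have -> : r v ^+ 2 = t + (tau - t / tau) ^+ 2 / 4.
    by rewrite /r -/t; field; exact: lt0r_neq0.
  by rewrite lerDl divr_ge0// sqr_ge0.
have h (v : {ffun 'I_m -> V}) := uniform_rudelson b0 K0 (r0 v) S0 n1 Q0 (fun i => vK (v i)) xb pt0 (fr v)
  mQ bJ QS XN Nb b1.
have : D <= 2 * \sum_v w v * (c * r v).
  apply: (le_trans (symmetrization f p0 p1)); rewrite ler_wpM2l//.
  apply: ler_sum => v _; rewrite ler_wpM2l// (le_trans (h v))//.
  by rewrite mulrAC.
have -> : \sum_v w v * (c * r v) = c / 2 * (tau + (D + 2 * m%:R) / tau).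
  transitivity (c / 2 * (\sum_v w v * (tau + 2 * m%:R / tau) + (\sum_v w v * dev v) / tau)).
    rewrite mulr_suml -big_split mulr_sumr/=; apply: eq_bigr => v _.
    by rewrite /r; field; exact: lt0r_neq0.
  by rewrite -mulr_suml w1 -/D; field; exact: lt0r_neq0.
rewrite -tau2.
have -> : 2 * (c / 2 * (tau + (D + 2 * tau ^+ 2) / tau)) = 3 * c * tau + D * (c / tau).
  by field; exact: lt0r_neq0.
have D0 : 0 <= D by apply: sumr_ge0 => v _; rewrite mulr_ge0//; exact: sup_norm_ge0.
have : D * (c / tau) <= D / 2 by rewrite ler_wpM2l// ler_pdivrMr// mulrC.
by lra.
Qed.

Definition grid_val (R : realType) (M : nat) (i : 'I_(2 * M).+1) : R :=
  (i%:R - M%:R) / M%:R.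

Lemma grid_val_round (R : realType) (M : nat) (x : R) : (0 < M)%N -> `|x| <= 1 ->
  exists i : 'I_(2 * M).+1, `|grid_val R i| <= `|x| /\ `|x - grid_val R i| <= M%:R^-1.
Proof.
move=> M0 x1; have MR : 0 < M%:R :> R by rewrite ltr0n.
have y0 : 0 <= M%:R * `|x| by rewrite mulr_ge0.
have /andP[N1 N2] := truncn_itv y0.
set N := Num.truncn _ in N1 N2.
have NM : (N <= M)%N by rewrite -(ler_nat R) (le_trans N1)// ler_piMr.
have [h|h] := lerP 0 x.
  have iP : (M + N < (2 * M).+1)%N by lia.
  exists (Ordinal iP); rewrite /grid_val/= natrD addrAC subrr add0r.
  rewrite (ger0_norm h) in N1 N2 *; rewrite ger0_norm ?divr_ge0//.
  rewrite ler_pdivrMr// mulrC N1; split=> //.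
  have -> : x - N%:R / M%:R = (M%:R * x - N%:R) / M%:R by field; exact: lt0r_neq0.
  rewrite normrM [`|_^-1|]ger0_norm ?invr_ge0// ler_piMl ?invr_ge0//.
  by rewrite ler_norml -natr1 in N2 *; lra.
have iP : (M - N < (2 * M).+1)%N by lia.
exists (Ordinal iP); rewrite /grid_val/= natrB// addrAC subrr add0r.
rewrite (ltr0_norm h) in N1 N2 *; rewrite normrM normrN ger0_norm// ger0_norm ?invr_ge0//.
rewrite ler_pdivrMr// mulrC N1; split=> //.
have -> : x - - N%:R / M%:R = (M%:R * x + N%:R) / M%:R by field; exact: lt0r_neq0.
rewrite normrM [`|_^-1|]ger0_norm ?invr_ge0// ler_piMl ?invr_ge0//.
by rewrite ler_norml -natr1 in N2 *; lra.
Qed.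

Definition grid_decode (R : realType) (n k M : nat)
    (s : {ffun 'I_k -> 'I_n * 'I_(2 * M).+1}) (j : 'I_n) : R :=
  if [pick r | (s r).1 == j] is Some r then grid_val R (s r).2 else 0.

Definition sparse_unit (R : realType) (n k : nat) (x : 'I_n -> R) : bool :=
  (#|[set j | x j != 0%R]%SET| <= k)%N && (\sum_j x j ^+ 2 <= 1).

Definition grid_pt (R : realType) (n k M : nat)
    (s : {ffun 'I_k -> 'I_n * 'I_(2 * M).+1}) : 'I_n -> R :=
  if sparse_unit k (grid_decode R s) then grid_decode R s else fun=> 0.

Lemma sparse_unit0 (R : realType) (n k : nat) : sparse_unit k (fun _ : 'I_n => 0 : R).
Proof.
rewrite /sparse_unit big1 ?ler01 ?andbT => [|j _]; last by rewrite expr0n.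
by rewrite (_ : [set j | _]%SET = finset.set0) ?cards0//; apply/setP => j; rewrite !inE eqxx.
Qed.

Lemma sparse_unit_grid_pt (R : realType) (n k M : nat)
    (s : {ffun 'I_k -> 'I_n * 'I_(2 * M).+1}) : sparse_unit k (grid_pt R s).
Proof. by rewrite /grid_pt; case: ifP => // _; exact: sparse_unit0. Qed.

(* AM-GM: [2 |x j| <= 1 / sqrt k + sqrt k * x j ^+ 2] on the support *)
Lemma sparse_unit_l1 (R : realType) (n k : nat) (x : 'I_n -> R) : (0 < k)%N ->
  sparse_unit k x -> \sum_j `|x j| <= Num.sqrt k%:R.
Proof.
move=> k0 /andP[xk x1]; set A := [set j | x j != 0]%SET in xk.
set b := Num.sqrt _; have b0 : 0 < b by rewrite sqrtr_gt0 ltr0n.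
have b2 : b ^+ 2 = k%:R by rewrite sqr_sqrtr.
have -> : \sum_j `|x j| = \sum_(j in A) `|x j|.
  rewrite [LHS](bigID (mem A))/= [X in _ + X]big1 ?addr0// => j.
  by rewrite inE negbK => /eqP ->; rewrite normr0.
have x1' : \sum_(j in A) x j ^+ 2 <= 1.
  apply: le_trans x1; rewrite [leRHS](bigID (mem A))/=.
  by rewrite lerDl sumr_ge0// => j _; rewrite sqr_ge0.
apply: (@le_trans _ _ (\sum_(j in A) (b^-1 + b * x j ^+ 2) / 2)).
  apply: ler_sum => j _; rewrite -[x j ^+ 2]real_normK ?num_real//; set y := `|x j|.
  have -> : (b^-1 + b * y ^+ 2) / 2 = y + b * (y - b^-1) ^+ 2 / 2.
    by field; exact: lt0r_neq0.
  by rewrite lerDl divr_ge0// mulr_ge0 ?sqr_ge0// ltW.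
rewrite -mulr_suml big_split/= sumr_const -mulr_sumr -[_ *+ _]mulr_natr.
have h : b^-1 * #|A|%:R <= b by rewrite ler_pdivrMl// -expr2 b2 ler_nat.
have := ler_wpM2l (ltW b0) x1'; lra.
Qed.

Lemma sparse_unit_entry (R : realType) (n k : nat) (x : 'I_n -> R) (j : 'I_n) :
  sparse_unit k x -> `|x j| <= 1.
Proof.
move=> /andP[_ x1]; rewrite -(@ler_pXn2r _ 2)// ?nnegrE// expr1n real_normK ?num_real//.
apply: le_trans x1; rewrite [leRHS](bigD1 j)//= lerDl.
by apply: sumr_ge0 => i _; rewrite sqr_ge0.
Qed.

Lemma grid_pt_cover (R : realType) (n k M : nat) (x : 'I_n -> R) :
  (0 < n)%N -> (0 < M)%N -> sparse_unit k x ->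
  exists s : {ffun 'I_k -> 'I_n * 'I_(2 * M).+1},
    forall j, `|grid_pt R s j| <= `|x j| /\ `|x j - grid_pt R s j| <= M%:R^-1.
Proof.
move=> n0 M0 xs; have /andP[xk x1] := xs.
have xj1 j : `|x j| <= 1 by exact: sparse_unit_entry xs.
have [rd rdP] := choice (fun j => grid_val_round M0 (xj1 j)).
set A := [set j | x j != 0]%SET in xk.
pose e (r : 'I_k) := nth (Ordinal n0) (enum A) r.
pose s : {ffun 'I_k -> 'I_n * 'I_(2 * M).+1} := [ffun r => (e r, rd (e r))].
have sE j : grid_decode R s j = grid_val R (rd j).
  rewrite /grid_decode; case: pickP => [r|nr]; first by rewrite ffunE/= => /eqP ->.
  have [xj|xj] := eqVneq (x j) 0.
    by apply/esym/eqP; rewrite -normr_le0; have [] := rdP j; rewrite xj normr0.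
  have jA : j \in enum A by rewrite mem_enum inE.
  have jk : (index j (enum A) < k)%N by rewrite (leq_trans _ xk)// cardE index_mem.
  by have := nr (Ordinal jk); rewrite ffunE/= /e nth_index// eqxx.
have su : sparse_unit k (grid_decode R s).
  apply/andP; split.
    rewrite (leq_trans _ xk)// subset_leq_card//; apply/fintype.subsetP => j.
    rewrite !inE sE; apply: contra_neq => xj.
    by apply/eqP; rewrite -normr_le0; have [] := rdP j; rewrite xj normr0.
  apply: le_trans x1; apply: ler_sum => j _; rewrite sE.
  rewrite -[leLHS]real_normK ?num_real// -[leRHS]real_normK ?num_real//.
  by rewrite lerXn2r ?nnegrE//; have [] := rdP j.
by exists s => j; rewrite /grid_pt su sE.
Qed.

Lemma card_grid (n k : nat) : (1 < n)%N ->
  (#|{ffun 'I_k -> 'I_n * 'I_(2 * (8 * n)).+1}| <= n ^ (7 * k))%N.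
Proof.
move=> n1; rewrite card_ffun card_prod !card_ord expnM.
have h : (n * (2 * (8 * n)).+1 <= n ^ 7)%N.
  have : (2 ^ 5 <= n ^ 5)%N by rewrite leq_exp2r.
  by rewrite (expnD n 5 2) -mulnn; move: (n ^ 5)%N => q; nia.
by case: k => // k; rewrite leq_exp2r.
Qed.

Definition rip_defect (R : realType) (m n : nat) (B : 'M[R]_(m, n)) (x : 'cV[R]_n) : R :=
  norm2 (B *m x) ^+ 2 - norm2 x ^+ 2.

Lemma norm2_sqr_comb (R : realType) (n : nat) (x y : 'cV[R]_n) (a b : R) :
  norm2 (a *: x + b *: y) ^+ 2 = a ^+ 2 * norm2 x ^+ 2 + b ^+ 2 * norm2 y ^+ 2
    + 2 * a * b * \sum_j x j ord0 * y j ord0.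
Proof.
rewrite !norm2_sqr !mulr_sumr -!big_split/=; apply: eq_bigr => j _.
by rewrite !mxE; ring.
Qed.

Lemma rip_defect_comb (R : realType) (m n : nat) (B : 'M[R]_(m, n)) (x y : 'cV[R]_n)
    (a b : R) :
  rip_defect B (a *: x + b *: y) = a ^+ 2 * rip_defect B x + b ^+ 2 * rip_defect B y
    + 2 * a * b * (\sum_i (B *m x) i ord0 * (B *m y) i ord0
                   - \sum_j x j ord0 * y j ord0).
Proof. by rewrite /rip_defect mulmxDr -!scalemxAr !norm2_sqr_comb; ring. Qed.

Lemma rip_const_ge0 (R : realType) (m n k : nat) (B : 'M[R]_(m, n)) :
  0 <= rip_const k B.
Proof. by have [[]] := rip_constP k B. Qed.

Lemma rip_defect_le (R : realType) (m n k : nat) (B : 'M[R]_(m, n)) (x : 'cV[R]_n) :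
  (#|supp x| <= k)%N -> `|rip_defect B x| <= rip_const k B * norm2 x ^+ 2.
Proof.
move=> xk; have [[_ /(_ x xk)/andP[h1 h2]] _] := rip_constP k B.
by rewrite ler_norml /rip_defect; apply/andP; split; lra.
Qed.

Lemma rip_constP_defect (R : realType) (m n k : nat) (B : 'M[R]_(m, n)) (c : R) :
  0 <= c -> (forall x, (#|supp x| <= k)%N -> norm2 x ^+ 2 = 1 -> `|rip_defect B x| <= c) ->
  rip_const k B <= c.
Proof.
move=> c0 Bc; have [_ minB] := rip_constP k B; apply: minB; split=> // x xk.
suff : `|rip_defect B x| <= c * norm2 x ^+ 2.
  by rewrite ler_norml /rip_defect => /andP[]; lra.
have [x0|x0] := eqVneq (norm2 x) 0.
  by have := rip_defect_le B xk; rewrite x0 expr0n mulr0 mulr0.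
have nx : 0 < norm2 x by rewrite lt_neqAle eq_sym x0 sqrtr_ge0.
have eN : norm2 ((norm2 x)^-1 *: x) ^+ 2 = 1.
  have := norm2_sqr_comb x x (norm2 x)^-1 0.
  by rewrite scale0r addr0 => ->; field.
have eD : rip_defect B ((norm2 x)^-1 *: x) = rip_defect B x / norm2 x ^+ 2.
  have := rip_defect_comb B x x (norm2 x)^-1 0.
  by rewrite scale0r addr0 => ->; field.
have := Bc ((norm2 x)^-1 *: x); rewrite eD normrM [`|_^-1|]ger0_norm ?invr_ge0 ?sqr_ge0//.
rewrite ler_pdivrMr ?exprn_gt0// => -> //.
rewrite (leq_trans _ xk)// subset_leq_card//; apply/fintype.subsetP => j.
by rewrite !inE mxE; apply: contra_neq => ->; rewrite mulr0.
Qed.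

(* [rip_defect x - rip_defect y = b(x - y, x + y)] for a symmetric form [b], and
   [4 b(u, v)] is the defect of [3 u + v / 3] minus that of [3 u - v / 3]. *)
Lemma rip_const_cover (R : realType) (m n k : nat) (B : 'M[R]_(m, n)) (c : R) :
  0 <= c ->
  (forall x, (#|supp x| <= k)%N -> norm2 x ^+ 2 = 1 ->
    exists y, [/\ supp y \subset supp x, norm2 y ^+ 2 <= 1,
      norm2 (x - y) ^+ 2 <= 1 / 64 & `|rip_defect B y| <= c]) ->
  rip_const k B <= 2 * c.
Proof.
move=> c0 cover; set d := rip_const k B.
have d0 : 0 <= d := rip_const_ge0 k B.
suff : d <= c + d / 2 by lra.
apply: rip_constP_defect => [|x xk x1]; first by rewrite addr_ge0// divr_ge0.
have [y [yx y1 xy yc]] := cover x xk x1.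
have comb_supp (a b : R) : (#|supp (a *: x + b *: y)| <= k)%N.
  rewrite (leq_trans _ xk)// subset_leq_card//; apply/fintype.subsetP => j.
  rewrite !inE !mxE; apply: contraNneq => xj.
  have /eqP yj : y j ord0 == 0.
    rewrite -[_ == _]negbK; apply/negP => yj.
    by have /fintype.subsetP/(_ j) := yx; rewrite !inE yj xj eqxx => /(_ isT).
  by rewrite xj yj !mulr0 addr0.
have h1 := rip_defect_le B (comb_supp (10 / 3) (- (8 / 3))).
have h2 := rip_defect_le B (comb_supp (8 / 3) (- (10 / 3))).
move: h1 h2 xy; rewrite -/d !rip_defect_comb !norm2_sqr_comb x1.
have -> : x - y = 1 *: x + (- 1) *: y by rewrite scale1r scaleN1r.
rewrite norm2_sqr_comb x1; move: yc y1.
set p := \sum_j x j ord0 * y j ord0; set q := _ - p.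
move: (rip_defect B x) (rip_defect B y) (norm2 y ^+ 2) => X Y Z.
rewrite !ler_norml => /andP[? ?] ? /andP[? ?] /andP[? ?] xy.
have hd : d * ((10 / 3) ^+ 2 * 1 + (- (8 / 3)) ^+ 2 * Z + 2 * (10 / 3) * (- (8 / 3)) * p)
   + d * ((8 / 3) ^+ 2 * 1 + (- (10 / 3)) ^+ 2 * Z + 2 * (8 / 3) * (- (10 / 3)) * p)
   <= d * 2.
  by rewrite -mulrDr ler_wpM2l//; lra.
by apply/andP; split; lra.
Qed.

Lemma measurable_finite_code d (T : measurableType d) (R : realType) (V : finType)
    (c : T -> V) (F : V -> R) :
  (forall u, measurable (c @^-1` [set u])) ->
  measurable_fun [set: T] (fun w => F (c w)).
Proof.
move=> mc _ Y mY; rewrite setTI.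
have -> : (fun w => F (c w)) @^-1` Y = \bigcup_(u in [set u | Y (F u)]) (c @^-1` [set u]).
  by apply/seteqP; split => [w /= Yw|w [u /= Yu cw]]; [by exists (c w)|by rewrite cw].
by apply: fin_bigcup_measurable => //; exact: finite_finset.
Qed.

Lemma integral_finite_code d (T : measurableType d) (R : realType)
    (P : probability T R) (V : finType) (c : T -> V) (F : V -> R) :
  (forall u, measurable (c @^-1` [set u])) -> (forall u, 0 <= F u) ->
  (\int[P]_w (F (c w))%:E =
   (\sum_u fine (P (c @^-1` [set u])) * F u)%:E)%E.
Proof.
move=> mc F0.
transitivity (\int[P]_w \sum_u ((F u)%:E * (\1_(c @^-1` [set u]) w)%:E))%E.
  apply: eq_integral => w _; rewrite (bigD1 (c w))//= big1 ?adde0 => [|u uw].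
    by rewrite indicE mem_set// mule1.
  by rewrite indicE memNset ?mule0//= => cw; rewrite cw eqxx in uw.
rewrite ge0_integral_sum//; last 2 first.
- move=> u; apply/measurable_EFinP; apply: measurable_funM => //.
- by move=> u w _; rewrite lee_fin mulr_ge0.
rewrite -sumEFin; apply: eq_bigr => u _.
rewrite ge0_integralZl_EFin//; last exact/measurable_EFinP.
by rewrite integral_indic// setIT EFinM fineK ?fin_num_measure// muleC.
Qed.

(* The integral of a nonnegative function is a supremum over simple functions, so
   [f] need not be measurable. *)
Lemma ae_le_integral_nonmeasurable d (T : measurableType d) (R : realType)
    (mu : {measure set T -> \bar R}) (f g : T -> \bar R) :
  (forall w, 0 <= f w)%E -> (forall w, 0 <= g w)%E -> measurable_fun [set: T] g ->
  {ae mu, forall w, (f w <= g w)%E} ->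
  (\int[mu]_w f w <= \int[mu]_w g w)%E.
Proof.
move=> f0 g0 mg fg; rewrite (ge0_integralTE mu f0).
apply: ge_ereal_sup => _ [h /= hf <-]; rewrite -integralT_nnsfun.
apply: ae_ge0_le_integral => //.
- by move=> w _; rewrite lee_fin; exact: fun_ge0.
- exact/measurable_EFinP.
- by apply: filterS fg => w fgw _; exact: le_trans (hf w) fgw.
Qed.

Lemma isotropic_quadratic d (T : measurableType d) (R : realType) (P : probability T R)
    (n : nat) (X : {RV P >-> n.-tuple R}) (x : 'I_n -> R) :
  isotropic P X ->
  (\int[P]_w (dot (fun j => tnth (X w) j) x ^+ 2)%:E = (\sum_j x j ^+ 2)%:E)%E.
Proof.
move=> iso.
have mX j : measurable_fun [set: T] (fun w => tnth (X w) j).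
  by apply: (measurableT_comp (measurable_tnth j)); exact: measurable_funPT.
have mXX j l : measurable_fun [set: T] (fun w => tnth (X w) j * tnth (X w) l).
  exact: measurable_funM.
have int2 j : P.-integrable [set: T] (fun w => (tnth (X w) j * tnth (X w) j)%:E).
  apply/integrableP; split; first exact/measurable_EFinP.
  under eq_integral do rewrite gee0_abs ?lee_fin -?expr2 ?sqr_ge0// expr2.
  by have := iso j j; rewrite unlock eqxx => ->; rewrite ltry.
have int j l : P.-integrable [set: T] (fun w => (tnth (X w) j * tnth (X w) l)%:E).
  apply: (le_integrable measurableT _ _ (integrableD measurableT (int2 j) (int2 l))).
    exact/measurable_EFinP.
  move=> w _; set u := tnth (X w) j; set v := tnth (X w) l.
  change (`|(u * v)%:E| <= `|(u * u + v * v)%:E|)%E; rewrite !abse_EFin lee_fin.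
  rewrite [leRHS]ger0_norm ?addr_ge0 -?expr2 ?sqr_ge0// ler_norml.
  by apply/andP; split; nra.
transitivity (\int[P]_w \sum_j \sum_l ((x j * x l)%:E * (tnth (X w) j * tnth (X w) l)%:E))%E.
  apply: eq_integral => w _.
  rewrite /dot expr2 mulr_suml -sumEFin; apply: eq_bigr => j _.
  rewrite mulr_sumr -sumEFin; apply: eq_bigr => l _.
  by rewrite -EFinM; congr (_%:E); ring.
rewrite integral_sum//; last first.
  by move=> j; apply: integrable_sum => // l _; exact: integrableZl.
rewrite -sumEFin; apply: eq_bigr => j _.
rewrite integral_sum//; last by move=> l; exact: integrableZl.
have e l : (\int[P]_w ((x j * x l)%:E * (tnth (X w) j * tnth (X w) l)%:E) =
    (x j * x l)%:E * (j == l)%:R%:E)%E.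
  by rewrite integralZl//; have := iso j l; rewrite unlock => ->.
rewrite (bigD1 j)//= big1 => [|l /negPf lj]; first by rewrite e eqxx mule1 adde0 expr2.
by rewrite e eq_sym lj mule0.
Qed.

Definition cell (R : realType) (K : R) (H N : nat) (x : R) : 'I_N.+1 :=
  inord (minn (Num.truncn ((x + K) * H%:R)) N).

Definition cell_val (R : realType) (K : R) (H : nat) (i : nat) : R := i%:R / H%:R - K.

Lemma cell_val_le (R : realType) (K : R) (H N : nat) (i : 'I_N.+1) :
  0 <= K -> (0 < H)%N -> N%:R <= 2 * K * H%:R -> `|cell_val K H i| <= K.
Proof.
move=> K0 H0 NK; have HR : 0 < H%:R :> R by rewrite ltr0n.
have iN : i%:R <= N%:R :> R by rewrite ler_nat -ltnS.
have : i%:R / H%:R <= 2 * K by rewrite ler_pdivrMr// (le_trans iN).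
have : 0 <= i%:R / H%:R :> R by rewrite divr_ge0// ltW.
by rewrite ler_norml /cell_val; lra.
Qed.

Lemma cell_near (R : realType) (K : R) (H : nat) (x : R) :
  (0 < H)%N -> `|x| <= K ->
  `|x - cell_val K H (cell K H (Num.truncn (2 * K * H%:R)) x)| <= H%:R^-1.
Proof.
move=> H0; rewrite ler_norml => /andP[x1 x2]; have HR : 0 < H%:R :> R by rewrite ltr0n.
have K0 : 0 <= K by lra.
set y := (x + K) * H%:R; have y0 : 0 <= y by rewrite mulr_ge0//; lra.
have yK : y <= 2 * K * H%:R by rewrite ler_pM2r//; lra.
have yN : (Num.truncn y <= Num.truncn (2 * K * H%:R))%N.
  by rewrite truncn_ge_nat ?(le_trans y0)// (le_trans _ yK)// truncn_le.
rewrite /cell -/y (minn_idPl yN) inordK ?ltnS// /cell_val.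
have /andP[h1 h2] := truncn_itv y0; rewrite -natr1 in h2.
have -> : x - ((Num.truncn y)%:R / H%:R - K) = (y - (Num.truncn y)%:R) / H%:R.
  by rewrite /y; field; exact: lt0r_neq0.
rewrite normrM [`|_^-1|]ger0_norm ?invr_ge0// ler_piMl ?invr_ge0//.
by rewrite ler_norml; lra.
Qed.

Lemma measurable_truncn (R : realType) (k : nat) :
  measurable [set y : R | Num.truncn y = k].
Proof.
have -> : [set y : R | Num.truncn y = k] =
    if k is 0%N then [set` `]-oo, 1[] else [set` `[k%:R, k.+1%:R[].
  apply/seteqP; split=> [y /= <-|y].
    have [y0|y0] := leP 0 y; last first.
      have -> : Num.truncn y = 0%N by apply/truncn0Pn; rewrite -ltNge (lt_trans y0).
      by rewrite /= in_itv/= (lt_trans y0).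
    have /andP[h1 h2] := truncn_itv y0.
    by case: (Num.truncn y) h1 h2 => [|j] h1 h2; rewrite /= in_itv/= ?h1 ?h2.
  case: k => [|k]; rewrite /= in_itv/=; last exact: truncn_def.
  by move=> y1; apply/truncn0Pn; rewrite -ltNge.
by case: k.
Qed.

Lemma measurable_cell (R : realType) (K : R) (H N : nat) (i : 'I_N.+1) :
  measurable (cell K H N @^-1` [set i]).
Proof.
pose h (x : R) := (x + K) * H%:R.
have mh : measurable_fun [set: R] h.
  by apply: measurable_funM => //; exact: measurable_funD.
have -> : cell K H N @^-1` [set i] = \bigcup_(k in [set k | inord (minn k N) = i])
    ([set: R] `&` h @^-1` [set y | Num.truncn y = k]).
  apply/seteqP; split=> [x /= xi|x [k /= ki [_ xk]]]; last by rewrite /cell -/(h x) xk.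
  by exists (Num.truncn (h x)).
apply: bigcup_measurable => k _; apply: mh => //; exact: measurable_truncn.
Qed.

Definition code (R : realType) (K : R) (H N n : nat) (t : n.-tuple R) :
  {ffun 'I_n -> 'I_N.+1} := [ffun j => cell K H N (tnth t j)].

Lemma measurable_code (R : realType) (K : R) (H N n : nat) u :
  measurable (@code R K H N n @^-1` [set u]).
Proof.
have -> : @code R K H N n @^-1` [set u] = \bigcap_(j in [set: 'I_n])
    ([set: n.-tuple R] `&` (fun t => tnth t j) @^-1` (cell K H N @^-1` [set u j])).
  apply/seteqP; split=> [t /= <- j _|t tu]; first by split=> //=; rewrite ffunE.
  by apply/ffunP => j; rewrite ffunE; have [] := tu j I.
apply: fin_bigcap_measurable => [|j _]; first exact: finite_finset.
by apply: measurable_tnth => //; exact: measurable_cell.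
Qed.

Lemma dot_sqr_near (R : realType) (n : nat) (K h : R) (a b x : 'I_n -> R) :
  (forall j, `|a j| <= K) -> (forall j, `|b j| <= K) -> (forall j, `|a j - b j| <= h) ->
  (forall j, `|x j| <= 1) ->
  `|dot a x ^+ 2 - dot b x ^+ 2| <= 2 * K * n%:R ^+ 2 * h.
Proof.
move=> aK bK ab x1.
have l1 : \sum_j `|x j| <= n%:R.
  rewrite -[X in _ <= X%:R]card_ord -sumr_const; apply: ler_sum => j _; exact: x1.
have e1 : dot a x - dot b x = dot (fun j => a j - b j) x.
  by rewrite /dot -sumrB; apply: eq_bigr => j _; rewrite mulrBl.
have e2 : dot a x + dot b x = dot (fun j => a j + b j) x.
  by rewrite /dot -big_split; apply: eq_bigr => j _; rewrite mulrDl.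
rewrite subr_sqr normrM e1 e2.
have [n0|n0] := posnP n.
  by subst n; rewrite /dot !big_ord0 normr0 expr0n mulr0 !mulr0 mul0r.
have K0 : 0 <= K := le_trans (normr_ge0 _) (aK (Ordinal n0)).
have h0 : 0 <= h := le_trans (normr_ge0 _) (ab (Ordinal n0)).
have h1 : `|dot (fun j => a j - b j) x| <= h * n%:R.
  by rewrite (le_trans (dot_l1 _ ab))// ler_wpM2l.
have h2 : `|dot (fun j => a j + b j) x| <= 2 * K * n%:R.
  rewrite (le_trans (@dot_l1 _ _ _ _ (2 * K) _))// ?ler_wpM2l ?mulr_ge0//.
  by move=> j; rewrite (le_trans (ler_normD _ _))// mulr_natl mulr2n lerD.
have -> : 2 * K * n%:R ^+ 2 * h = h * n%:R * (2 * K * n%:R) by ring.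
by rewrite ler_pM.
Qed.

Lemma rip_const_grid (R : realType) (m n k : nat) (B : 'M[R]_(m, n)) (c : R) :
  (0 < n)%N -> 0 <= c ->
  (forall s : {ffun 'I_k -> 'I_n * 'I_(2 * (8 * n)).+1},
    `|rip_defect B (\col_j grid_pt R s j)| <= c) ->
  rip_const k B <= 2 * c.
Proof.
move=> n0 c0 Bc; apply: rip_const_cover => // x xk x1.
have nR : 0 < n%:R :> R by rewrite ltr0n.
have M0 : (0 < 8 * n)%N by rewrite muln_gt0.
have xs : sparse_unit k (fun j => x j ord0).
  apply/andP; split; first exact: xk.
  by rewrite -norm2_sqr x1.
have [s sP] := grid_pt_cover n0 M0 xs.
exists (\col_j grid_pt R s j); split => //.
- apply/fintype.subsetP => j; rewrite !inE mxE; apply: contra_neq => xj.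
  by apply/eqP; rewrite -normr_le0; have [] := sP j; rewrite xj normr0.
- rewrite norm2_sqr; have /andP[_] := sparse_unit_grid_pt R s.
  by under [X in _ -> X <= _]eq_bigr do rewrite mxE.
- rewrite norm2_sqr (@le_trans _ _ (\sum_(j < n) ((8 * n)%:R^-1) ^+ 2))//.
    apply: ler_sum => j _; rewrite !mxE -[leLHS]real_normK ?num_real//.
    by rewrite lerXn2r ?nnegrE ?invr_ge0//; have [] := sP j.
  rewrite sumr_const card_ord natrM -[_ *+ n]mulr_natl.
  have -> : n%:R * ((8%:R * n%:R)^-1) ^+ 2 = 1 / 64 * n%:R^-1 :> R.
    by field; exact: lt0r_neq0.
  by rewrite ler_piMr// invf_le1// ler1n.
Qed.

Lemma rip_defect_rows (R : realType) (m n : nat) (A : 'M[R]_(m, n)) (x : 'I_n -> R) :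
  (0 < m)%N ->
  rip_defect ((Num.sqrt m%:R)^-1 *: A) (\col_j x j) =
  (\sum_i dot (A i) x ^+ 2) / m%:R - \sum_j x j ^+ 2.
Proof.
move=> m0; rewrite /rip_defect !norm2_sqr; congr (_ - _); last first.
  by apply: eq_bigr => j _; rewrite mxE.
rewrite mulr_suml; apply: eq_bigr => i _.
rewrite -scalemxAl mxE exprMn exprVn sqr_sqrtr// mulrC; congr (_ ^+ 2 / _).
by rewrite mxE; apply: eq_bigr => j _; rewrite mxE.
Qed.

Lemma cell_mean d (T : measurableType d) (R : realType) (P : probability T R)
    (n H N : nat) (K eta : R) (X : {RV P >-> n.-tuple R}) (x : 'I_n -> R) :
  isotropic P X -> 0 <= eta ->
  {ae P, forall w, `|dot (fun j => tnth (X w) j) x ^+ 2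
     - dot (fun j => cell_val K H (code K H N (X w) j)) x ^+ 2| <= eta} ->
  `|\sum_u fine (P ((@code R K H N n \o X) @^-1` [set u]))
      * dot (fun j => cell_val K H (u j)) x ^+ 2 - \sum_j x j ^+ 2| <= eta.
Proof.
move=> iso eta0 near.
pose Y w := dot (fun j => tnth (X w) j) x ^+ 2.
pose F (u : {ffun 'I_n -> 'I_N.+1}) := dot (fun j => cell_val K H (u j)) x ^+ 2.
pose c := @code R K H N n \o X.
have mc u : measurable (c @^-1` [set u]).
  rewrite -[X in measurable X]setTI comp_preimage.
  by apply: (measurable_funPT X) => //; exact: measurable_code.
have mF : measurable_fun [set: T] (fun w => F (c w)) by exact: measurable_finite_code.
have mY : measurable_fun [set: T] Y.
  apply: measurable_funX; apply: measurable_sum => j; apply: measurable_funM => //.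
  by apply: (measurableT_comp (measurable_tnth j)); exact: measurable_funPT.
have F0 u : 0 <= F u by exact: sqr_ge0.
have Y0 w : 0 <= Y w by exact: sqr_ge0.
have iY : (\int[P]_w (Y w)%:E = (\sum_j x j ^+ 2)%:E)%E by exact: isotropic_quadratic.
have iF := integral_finite_code P mc F0.
have shift (f g : T -> R) (a b : R) : measurable_fun [set: T] f ->
    measurable_fun [set: T] g -> (forall w, 0 <= f w) -> (forall w, 0 <= g w) ->
    (\int[P]_w (f w)%:E = a%:E)%E -> (\int[P]_w (g w)%:E = b%:E)%E ->
    {ae P, forall w, f w <= g w + eta} -> a <= b + eta.
  move=> mf mg f0 g0 fa gb fg.
  have : (\int[P]_w (f w)%:E <= \int[P]_w ((g w)%:E + (cst eta%:E) w))%E.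
    apply: ae_ge0_le_integral => //.
    - by move=> w _; rewrite lee_fin.
    - exact/measurable_EFinP.
    - by move=> w _; rewrite -EFinD lee_fin addr_ge0.
    - by apply: emeasurable_funD => //; exact/measurable_EFinP.
    - by apply: filterS fg => w fgw _; rewrite -EFinD lee_fin.
  rewrite ge0_integralD//; last 2 first.
  - by move=> w _; rewrite lee_fin.
  - exact/measurable_EFinP.
  by rewrite fa gb integral_cst//= probability_setT mule1 -EFinD lee_fin.
have h1 : \sum_u fine (P (c @^-1` [set u])) * F u <= \sum_j x j ^+ 2 + eta.
  apply: (shift _ _ _ _ mF mY) => //.
  by apply: filterS near => w; rewrite ler_norml -/(Y w) -/(F (c w)); lra.
have h2 : \sum_j x j ^+ 2 <= \sum_u fine (P (c @^-1` [set u])) * F u + eta.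
  apply: (shift _ _ _ _ mY mF) => //.
  by apply: filterS near => w; rewrite ler_norml -/(Y w) -/(F (c w)); lra.
by rewrite ler_norml; apply/andP; split; lra.
Qed.

Lemma independent_code d (T : measurableType d) (R : realType) (P : probability T R)
    (m n H N : nat) (K : R) (A : 'I_m -> {RV P >-> n.-tuple R}) v :
  mutually_independent P A ->
  fine (P ((fun w => [ffun i => code K H N (A i w)]) @^-1` [set v])) =
  prod_weight (fun i u => fine (P ((@code R K H N n \o A i) @^-1` [set u]))) v.
Proof.
move=> ind.
have -> : (fun w => [ffun i => code K H N (A i w)]) @^-1` [set v] =
    \bigcap_(i in [set` [set: 'I_m]%SET]) (A i @^-1` (@code R K H N n @^-1` [set v i])).
  apply/seteqP; split=> [w /= <- i _|w wv]; first by rewrite /= ffunE.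
  by apply/ffunP => i; rewrite ffunE; apply: wv; rewrite /= inE.
rewrite ind; last by move=> i _; exact: measurable_code.
rewrite (eq_bigl predT) => [|i]; last by rewrite finset.in_setT.
have mA i u : measurable ((@code R K H N n \o A i) @^-1` [set u]).
  rewrite -[X in measurable X]setTI comp_preimage.
  by apply: (measurable_funPT (A i)) => //; exact: measurable_code.
rewrite (eq_bigr (fun i =>
    (fine (P ((@code R K H N n \o A i) @^-1` [set v i])))%:E)); last first.
  by move=> i _; rewrite fineK ?fin_num_measure.
by rewrite prodEFin.
Qed.

Lemma expectation_rip_const d (T : measurableType d) (R : realType)
    (P : probability T R) (m n k Q J : nat) (K S eta : R)
    (A : 'I_m -> {RV P >-> n.-tuple R}) :
  mutually_independent P A -> (forall i, isotropic P (A i)) ->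
  (forall i j, {ae P, forall w, `|tnth (A i w) j| <= K}) ->
  0 < K -> 0 < S -> 0 < eta <= 1 -> (1 < n)%N -> (0 < m)%N -> (0 < k)%N -> (0 < Q)%N ->
  2 * m%:R <= expR (Q%:R : R) -> Num.sqrt k%:R <= 2 ^+ J :> R ->
  Q%:R * ln n%:R <= S ^+ 2 ->
  2 ^+ 14 * (K * Num.sqrt k%:R) * S * J.+1%:R <= Num.sqrt m%:R / 2 ->
  ('E_P[fun w => rip_const k ((Num.sqrt m%:R)^-1 *: random_mx A w)%R] <=
   (2 * (6 * (2 ^+ 14 * (K * Num.sqrt k%:R) * S * J.+1%:R) / Num.sqrt m%:R
     + 2 * eta))%:E)%E.
Proof.
move=> ind iso bdd K0 S0 /andP[eta0 eta1] n1 m0 k0 Q0 mQ bJ QS ct.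
have n0 : (0 < n)%N by exact: ltn_trans n1.
have M0 : (0 < 8 * n)%N by rewrite muln_gt0.
have mR : 0 < m%:R :> R by rewrite ltr0n.
set b := Num.sqrt k%:R in bJ ct *; set tau := Num.sqrt m%:R in ct *.
set c := 2 ^+ 14 * _ * _ * _ in ct *.
have tau0 : 0 < tau by rewrite sqrtr_gt0.
have tau2 : tau ^+ 2 = m%:R by rewrite sqr_sqrtr.
pose r := 2 * K * n%:R ^+ 2 / eta.
have r0 : 0 <= r by rewrite divr_ge0 ?mulr_ge0 ?exprn_ge0// ltW.
pose H := (Num.truncn r).+1; pose N := Num.truncn (2 * K * H%:R).
have HR : 0 < H%:R :> R by rewrite ltr0n.
have KH0 : 0 <= 2 * K * H%:R by rewrite !mulr_ge0 ?ltW.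
have NK : N%:R <= 2 * K * H%:R by rewrite truncn_le.
have Heta : 2 * K * n%:R ^+ 2 * H%:R^-1 <= eta.
  rewrite ler_pdivrMr// [eta * _]mulrC -ler_pdivrMr// -/r.
  by have /andP[_ /ltW] := truncn_itv r0.
pose X := {ffun 'I_k -> 'I_n * 'I_(2 * (8 * n)).+1}.
pose pt (s : X) := grid_pt R s.
have su s : sparse_unit k (pt s) by exact: sparse_unit_grid_pt.
have [s0 s0P] := grid_pt_cover n0 M0 (sparse_unit0 R n k).
have pt0 j : pt s0 j = 0 by apply/eqP; rewrite -normr_le0; have [] := s0P j; rewrite normr0.
pose V := {ffun 'I_n -> 'I_N.+1}.
pose val (u : V) j : R := cell_val K H (u j).
have vK u j : `|val u j| <= K by apply: cell_val_le => //; exact: ltW.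
pose cd i := @code R K H N n \o A i.
have mcd i u : measurable (cd i @^-1` [set u]).
  rewrite -[X in measurable X]setTI comp_preimage.
  by apply: (measurable_funPT (A i)) => //; exact: measurable_code.
pose p i u : R := fine (P (cd i @^-1` [set u])).
have p0 i u : 0 <= p i u by exact: fine_ge0.
have p1 i : \sum_u p i u = 1.
  have := integral_finite_code P (F := fun=> 1) (mcd i) (fun=> ler01).
  under [X in _ = X%:E]eq_bigr do rewrite mulr1.
  by rewrite integral_cst//= probability_setT mule1 => -[].
have bddT : {ae P, forall w, forall i j, `|tnth (A i w) j| <= K}.
  by apply: filter_forall => i; apply: filter_forall => j; exact: bdd.
have near : {ae P, forall w, forall i s,
    `|dot (fun j => tnth (A i w) j) (pt s) ^+ 2 - dot (val (cd i w)) (pt s) ^+ 2| <= eta}.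
  apply: filterS bddT => w bw i s; apply: le_trans Heta.
  apply: dot_sqr_near => // j; last exact: sparse_unit_entry (su s).
  by rewrite /val /cd/= ffunE; apply: cell_near.
have mean i s : `|\sum_u p i u * dot (val u) (pt s) ^+ 2 - \sum_j pt s j ^+ 2| <= eta.
  by apply: cell_mean => //; [exact: ltW|apply: filterS near].
have norm1 s : \sum_j pt s j ^+ 2 <= 1 by have /andP[] := su s.
pose dev (v : {ffun 'I_m -> V}) := sup_norm (fun s => \sum_i (dot (val (v i)) (pt s) ^+ 2
   - \sum_u p i u * dot (val u) (pt s) ^+ 2)).
have devle : \sum_v prod_weight p v * dev v <= 6 * c * tau.
  apply: (@finite_deviation R m n Q J (7 * k) K b S V X s0) => //.
  - move=> s; rewrite -[X in _ * X%:R]card_ord mulr_natr -sumr_const.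
    apply: ler_sum => i _; have := mean i s; have := norm1 s; rewrite ler_norml; lra.
  - by move=> s; apply: sparse_unit_l1.
  - exact: card_grid.
  - by rewrite sqr_sqrtr// natrM.
  - by rewrite -sqrtr1 ler_wsqrtr// ler1n.
pose G v := 2 * (dev v / m%:R + 2 * eta).
pose cw w : {ffun 'I_m -> V} := [ffun i => code K H N (A i w)].
have mcw v : measurable (cw @^-1` [set v]).
  have -> : cw @^-1` [set v] = \bigcap_(i in [set: 'I_m]) (cd i @^-1` [set v i]).
    apply/seteqP; split=> [w /= <- i _|w wv]; first by rewrite /= ffunE.
    by apply/ffunP => i; rewrite ffunE; exact: wv.
  by apply: fin_bigcap_measurable => //; exact: finite_finset.
have dev0 v : 0 <= dev v by exact: sup_norm_ge0.
have G0 v : 0 <= G v by rewrite mulr_ge0// addr_ge0// ?divr_ge0// mulr_ge0// ltW.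
rewrite unlock.
apply: (@le_trans _ _ (\int[P]_w (G (cw w))%:E)%E).
  apply: ae_le_integral_nonmeasurable.
  - by move=> w; rewrite lee_fin rip_const_ge0.
  - by move=> w; rewrite lee_fin.
  - by apply/measurable_EFinP; exact: measurable_finite_code.
  apply: filterS near => w nw; rewrite lee_fin; apply: rip_const_grid => //.
    by rewrite addr_ge0// ?divr_ge0// mulr_ge0// ltW.
  move=> s; rewrite -/(pt s) rip_defect_rows//.
  have rowE i : dot ((random_mx A w) i) (pt s) = dot (fun j => tnth (A i w) j) (pt s).
    by apply: eq_bigr => j _; rewrite mxE.
  under eq_bigr do rewrite rowE.
  set nrm := \sum_j pt s j ^+ 2.
  pose a i := dot (fun j => tnth (A i w) j) (pt s) ^+ 2.
  pose a' i := dot (val (cd i w)) (pt s) ^+ 2.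
  pose g i := \sum_u p i u * dot (val u) (pt s) ^+ 2.
  have -> : (\sum_i a i) / m%:R - nrm =
      (\sum_i (a' i - g i)) / m%:R + (\sum_i ((a i - a' i) + (g i - nrm))) / m%:R.
    have nE : nrm = (\sum_(i < m) nrm) / m%:R.
      by rewrite sumr_const card_ord -[_ *+ m]mulr_natr mulfK ?lt0r_neq0.
    rewrite [X in _ - X = _]nE -!mulrBl -mulrDl -sumrB -big_split/=; congr (_ / _).
    by apply: eq_bigr => i _; ring.
  rewrite (le_trans (ler_normD _ _))// lerD//.
    rewrite normrM [`|_^-1|]ger0_norm ?invr_ge0// ler_wpM2r ?invr_ge0//.
    have := sup_norm_ge (fun s => \sum_i (dot (val (cw w i)) (pt s) ^+ 2
      - \sum_u p i u * dot (val u) (pt s) ^+ 2)) s.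
    by under eq_bigr do rewrite ffunE.
  rewrite normrM [`|_^-1|]ger0_norm ?invr_ge0// ler_pdivrMr//.
  rewrite (le_trans (ler_norm_sum _ _ _))// -[X in _ * X%:R]card_ord mulr_natr -sumr_const.
  apply: ler_sum => i _; have := nw i s; have := mean i s.
  rewrite -/(a i) -/(a' i) -/(g i) -/nrm => h1 h2.
  by rewrite (le_trans (ler_normD _ _))//; lra.
rewrite (integral_finite_code P mcw G0) lee_fin.
under eq_bigr do rewrite independent_code//.
have w1 := prod_weight_sum p1.
have -> : \sum_v prod_weight p v * G v =
    2 * ((\sum_v prod_weight p v * dev v) / m%:R + 2 * eta).
  transitivity (\sum_v (2 / m%:R * (prod_weight p v * dev v)
      + 4 * eta * prod_weight p v)).
    by apply: eq_bigr => v _; rewrite /G; field; exact: lt0r_neq0.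
  by rewrite big_split/= -!mulr_sumr w1; field; exact: lt0r_neq0.
rewrite ler_wpM2l// lerD2r ler_pdivrMr// (le_trans devle)// -tau2.
rewrite le_eqVlt; apply/orP; left; apply/eqP.
by field; exact: lt0r_neq0.
Qed.

Lemma ln_sublinear (R : realType) (x : R) : 0 < x -> ln x <= x - 1.
Proof. by move=> x0; have := expR_ge1Dx (ln x); rewrite lnK ?posrE//; lra. Qed.

Lemma ln2_bounds (R : realType) : 1 / 2 <= (ln 2 : R) <= 1.
Proof.
have := @ln_sublinear R 2; have := @ln_sublinear R (2^-1).
by rewrite lnV ?posrE// => h1 h2; apply/andP; split; lra.
Qed.

Lemma log2_le_id (R : realType) (x : R) : 0 < x -> log2 x <= x.
Proof.
move=> x0; have /andP[l1 l2] := ln2_bounds R.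
have x2 : 0 < x / 2 by rewrite divr_gt0.
have h := ln_sublinear x2; rewrite ln_div ?posrE// in h.
by rewrite /log2 ler_pdivrMr; [nra|lra].
Qed.

Lemma log2M (R : realType) (x y : R) : 0 < x -> 0 < y -> log2 (x * y) = log2 x + log2 y.
Proof. by move=> x0 y0; rewrite /log2 lnM ?posrE// mulrDl. Qed.

Lemma log2_ge (R : realType) (x : R) (j : nat) : 2 ^+ j <= x -> j%:R <= log2 x.
Proof.
move=> jx; have ln20 : 0 < ln 2 :> R by have /andP[] := ln2_bounds R; lra.
have p0 : 0 < 2 ^+ j :> R by rewrite exprn_gt0.
rewrite /log2 ler_pdivlMr// mulr_natl -lnXn//.
by rewrite ler_ln ?posrE// (lt_le_trans p0).
Qed.

Lemma ln_le_log2 (R : realType) (x : R) : 1 <= x -> ln x <= log2 x.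
Proof.
move=> x1; have /andP[l1 l2] := ln2_bounds R.
by rewrite /log2 ler_pdivlMr; [rewrite ler_piMr// ln_ge0|lra].
Qed.

Lemma up_log2_le (R : realType) (x : nat) : (0 < x)%N ->
  (up_log 2 x)%:R <= log2 x%:R + 1 :> R.
Proof.
move=> x0; case E : (up_log 2 x) => [|j].
  by rewrite addr_ge0// (@log2_ge R _ 0)// expr0 ler1n.
rewrite -natr1 lerD2r; apply: log2_ge; rewrite -natrX ler_nat ltnW//.
rewrite ltnNge; apply/negP => /up_log_min => /(_ isT).
by rewrite E ltnn.
Qed.

(* Inverts [m >= C s log s]: with [y = m / (s log s)] one has
   [log m <= 2 log s + log y] and [log y <= 2 sqrt y]. *)
Lemma log2_inversion (R : realType) (c s m : R) : 1 <= c -> 2 <= s ->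
  (8 * c) ^+ 2 * (s * log2 s) <= m -> c * s * (log2 m + 2) <= m.
Proof.
move=> c1 s2 sm.
have l1 : 1 <= log2 s by rewrite (@log2_ge R _ 1).
set l := log2 s in sm l1.
have s0 : 0 < s by lra.
have l0 : 0 < l by lra.
have sl0 : 0 < s * l by rewrite mulr_gt0.
have c8 : 0 < (8 * c) ^+ 2 by rewrite exprn_gt0//; lra.
have m0 : 0 < m by apply: lt_le_trans sm; rewrite mulr_gt0.
have [y [y0 mE yc]] : exists y, [/\ 0 < y, m = s * l * y & (8 * c) ^+ 2 <= y].
  exists (m / (s * l)); split; first by rewrite divr_gt0.
    by rewrite mulrC divfK// lt0r_neq0.
  by rewrite ler_pdivlMr.
set t := Num.sqrt y.
have t0 : 0 < t by rewrite sqrtr_gt0.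
have t2 : t * t = y by rewrite -expr2 sqr_sqrtr// ltW.
have tc : 8 * c <= t.
  rewrite -(@ler_pXn2r _ 2)// ?nnegrE ?sqrtr_ge0//; last by lra.
  by rewrite sqr_sqrtr// ltW.
have logm : log2 m <= 2 * l + 2 * t.
  rewrite mE (log2M sl0 y0) (log2M s0 l0) -t2 (log2M t0 t0) -/l.
  by have := log2_le_id l0; have := log2_le_id t0; lra.
apply: (@le_trans _ _ (s * l * (c * (4 + 2 * t)))).
  have -> : s * l * (c * (4 + 2 * t)) = c * s * (l * (4 + 2 * t)) by ring.
  rewrite ler_wpM2l ?mulr_ge0//; [lra|lra|].
  by rewrite (le_trans (_ : _ <= 2 * l + 2 * t + 2)) ?lerD2r//; nra.
by rewrite mE ler_wpM2l ?(ltW sl0)// -t2; nra.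
Qed.

Theorem theorem5p71 (R : realType) (K : R) :
  exists C : R, 0 < C /\
  forall (d : measure_display) (T : measurableType d) (P : probability T R)
    (m n : nat) (A : 'I_m -> {RV P >-> n.-tuple R}),
    mutually_independent P A ->
    (forall i : 'I_m, isotropic P (A i)) ->
    (forall (i : 'I_m) (j : 'I_n), {ae P, forall w, `|tnth (A i w) j| <= K}) ->
    (m <= n)%N ->
    forall (k : nat) (delta : R),
      (1 < k <= n)%N ->
      0 < delta < 1 ->
      C * delta ^- 2 * k%:R * log2 n%:R * log2 k%:R ^+ 2
        * log2 (delta ^- 2 * k%:R * log2 n%:R * log2 k%:R ^+ 2) <= m%:R ->
      ('E_P[fun w => rip_const k ((Num.sqrt m%:R)^-1 *: random_mx A w)%R]
        <= delta%:E)%E.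
Proof.
pose K1 := Num.max K 1; have K11 : 1 <= K1 by rewrite le_max lexx orbT.
pose c2 := 2 ^+ 41 * K1 ^+ 2.
have c21 : 1 <= c2 by rewrite -[1]mulr1 ler_pM ?exprn_ege1// ler1n.
exists ((8 * c2) ^+ 2); split; first by rewrite exprn_gt0// mulr_gt0//; exact: lt_le_trans c21.
move=> d T P m n A ind iso bdd mn k delta /andP[k1 kn] /andP[de0 de1].
have n1 : (1 < n)%N by exact: leq_trans kn.
set Ln := log2 n%:R; set Lk := log2 k%:R.
set s := delta ^- 2 * _ * _ * _ => hm.
have Ln1 : 1 <= Ln by rewrite (@log2_ge R _ 1)// expr1 ler_nat.
have Lk1 : 1 <= Lk by rewrite (@log2_ge R _ 1)// expr1 ler_nat.
have sE : delta ^+ 2 * s = k%:R * Ln * Lk ^+ 2.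
  by rewrite /s; field; exact: lt0r_neq0.
have k2 : 2 <= k%:R :> R by rewrite ler_nat.
have s2 : 2 <= s.
  have : 2 <= k%:R * Ln * Lk ^+ 2.
    by rewrite -[2]mulr1 -[2 * 1]mulr1 ler_pM ?exprn_ege1// ler_pM.
  rewrite -sE => h; apply: (le_trans h); rewrite ler_piMl//.
    by rewrite ltW// -(@pmulr_rgt0 _ (delta ^+ 2)) ?exprn_gt0// (lt_le_trans _ h).
  by rewrite exprn_ile1// ltW.
have hm' : c2 * s * (log2 m%:R + 2) <= m%:R.
  apply: log2_inversion => //; apply: le_trans hm.
  by rewrite le_eqVlt; apply/orP; left; apply/eqP; rewrite /s; ring.
have m0 : (0 < m)%N.
  rewrite lt0n; apply/eqP => m0; move: hm; rewrite m0 leNgt => /negP; apply.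
  have ls : 0 < log2 s by rewrite (lt_le_trans _ (@log2_ge R s 1 _)) ?expr1.
  have c20 : 0 < (8 * c2) ^+ 2 by rewrite exprn_gt0// mulr_gt0// (lt_le_trans _ c21).
  have -> : (8 * c2) ^+ 2 * delta ^- 2 * k%:R * Ln * Lk ^+ 2 * log2 s =
    (8 * c2) ^+ 2 * s * log2 s by rewrite /s; ring.
  by rewrite mulr_gt0// mulr_gt0// (lt_le_trans _ s2).
have mR : 1 <= m%:R :> R by rewrite ler1n.
pose J := up_log 2 k; pose Q := up_log 2 (2 * m).
have J3 : J.+1%:R <= 3 * Lk.
  rewrite -natr1; have := up_log2_le R (ltnW k1); rewrite -/J -/Lk; lra.
have Qm : Q%:R <= log2 m%:R + 2 :> R.
  have m2 : (0 < 2 * m)%N by rewrite muln_gt0.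
  have := up_log2_le R m2; rewrite -/Q natrM log2M ?ltr0n//.
  have -> : log2 2%:R = 1 :> R.
    by rewrite /log2 divff// lt0r_neq0//; have /andP[] := ln2_bounds R; lra.
  by lra.
have Q0 : (0 < Q)%N by rewrite up_log_gt0 (leq_mul (leqnn 2) m0).
have mQ : 2 * m%:R <= expR (Q%:R : R).
  rewrite -natrM (@le_trans _ _ (2 ^+ Q))//.
    by rewrite -natrX ler_nat up_logP.
  rewrite -[leLHS]lnK ?posrE ?exprn_gt0// ler_expR lnXn// -[_ *+ Q]mulr_natl ler_piMr//.
  by have /andP[] := ln2_bounds R.
have kJ : Num.sqrt k%:R <= 2 ^+ J :> R.
  rewrite -(@ler_pXn2r _ 2)// ?nnegrE ?sqrtr_ge0 ?exprn_ge0// sqr_sqrtr//.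
  rewrite (@le_trans _ _ (2 ^+ J))//; first by rewrite -natrX ler_nat up_logP.
  by rewrite expr2 ler_peMl ?exprn_ge0// exprn_ege1// ler1n.
pose S := Num.sqrt (Q%:R * Ln).
have QR : 1 <= Q%:R :> R by rewrite ler1n.
have S2 : S ^+ 2 = Q%:R * Ln by rewrite sqr_sqrtr// mulr_ge0//; lra.
have S0 : 0 < S by rewrite sqrtr_gt0 mulr_gt0//; lra.
have QS : Q%:R * ln n%:R <= S ^+ 2.
  by rewrite S2 ler_wpM2l// ln_le_log2// ler1n ltnW.
set tau := Num.sqrt m%:R.
have tau0 : 0 < tau by rewrite sqrtr_gt0 ltr0n.
pose c := 2 ^+ 14 * (K1 * Num.sqrt k%:R) * S * J.+1%:R.
have K10 : 0 < K1 by exact: lt_le_trans K11.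
have c0 : 0 <= c.
  by rewrite mulr_ge0// mulr_ge0 ?(ltW S0)// mulr_ge0 ?exprn_ge0// mulr_ge0 ?sqrtr_ge0// ltW.
have hc : c <= delta * tau / 24.
  rewrite -(@ler_pXn2r _ 2)// ?nnegrE//; last first.
    by rewrite divr_ge0// mulr_ge0 ?ltW.
  have -> : (delta * tau / 24) ^+ 2 = delta ^+ 2 * m%:R / 24 ^+ 2.
    by rewrite -(@sqr_sqrtr _ m%:R)// -/tau; field.
  have -> : c ^+ 2 = 2 ^+ 28 * K1 ^+ 2 * k%:R * (Q%:R * Ln) * J.+1%:R ^+ 2.
    by rewrite -S2 -(@sqr_sqrtr _ k%:R)//; rewrite /c; ring.
  have JJ : J.+1%:R ^+ 2 <= (3 * Lk) ^+ 2 by rewrite lerXn2r ?nnegrE// mulr_ge0//; lra.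
  have X0 : 0 <= 2 ^+ 28 * K1 ^+ 2 * k%:R * Ln.
    by rewrite mulr_ge0 ?(le_trans _ Ln1)// mulr_ge0// mulr_ge0 ?exprn_ge0// ltW.
  have lm0 : 0 <= log2 m%:R + 2 :> R by rewrite addr_ge0// (@log2_ge R _ 0) ?expr0.
  rewrite ler_pdivlMr ?exprn_gt0//.
  apply: (@le_trans _ _ (2 ^+ 28 * K1 ^+ 2 * k%:R * Ln *
      ((log2 m%:R + 2) * (3 * Lk) ^+ 2) * 24 ^+ 2)).
    rewrite ler_pM2r ?exprn_gt0//.
    rewrite (_ : _ * J.+1%:R ^+ 2 =
      2 ^+ 28 * K1 ^+ 2 * k%:R * Ln * (Q%:R * J.+1%:R ^+ 2)); last by ring.
    by rewrite ler_wpM2l// ler_pM// exprn_ge0.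
  apply: (@le_trans _ _ (delta ^+ 2 * (c2 * s * (log2 m%:R + 2)))); last first.
    by rewrite ler_wpM2l ?sqr_ge0.
  have -> : delta ^+ 2 * (c2 * s * (log2 m%:R + 2)) =
      2 ^+ 41 * (K1 ^+ 2 * k%:R * Ln * Lk ^+ 2 * (log2 m%:R + 2)).
    by rewrite -[RHS]mulr1 /c2; transitivity (2 ^+ 41 * K1 ^+ 2 * (delta ^+ 2 * s) *
      (log2 m%:R + 2)); [ring|rewrite sE; ring].
  have -> : 2 ^+ 28 * K1 ^+ 2 * k%:R * Ln * ((log2 m%:R + 2) * (3 * Lk) ^+ 2) * 24 ^+ 2 =
      2 ^+ 28 * 5184 * (K1 ^+ 2 * k%:R * Ln * Lk ^+ 2 * (log2 m%:R + 2)) by ring.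
  rewrite ler_wpM2r//.
    rewrite mulr_ge0// mulr_ge0 ?sqr_ge0// mulr_ge0 ?(le_trans _ Ln1)//.
    by rewrite mulr_ge0 ?sqr_ge0.
  rewrite (_ : 41 = 28 + 13)%N// exprD ler_wpM2l ?exprn_ge0// -natrX ler_nat.
  by [].
have bdd1 i j : {ae P, forall w, `|tnth (A i w) j| <= K1}.
  by apply: filterS (bdd i j) => w h; rewrite le_max h.
have eta01 : 0 < delta / 8 <= 1 by apply/andP; split; lra.
have ct : c <= tau / 2 by apply: (le_trans hc); nra.
have := expectation_rip_const ind iso bdd1 K10 S0 eta01 n1 m0 (ltnW k1) Q0 mQ kJ QS ct.
move=> h; apply: (le_trans h); rewrite lee_fin -/c -/tau.
have : 6 * c / tau <= delta / 4 by rewrite ler_pdivrMr//; lra.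
by lra.
Qed.
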